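(* Let $\mu$ be a continuous (i.e. atomless) Borel probability measure on $\mathbb{T}$ supported on a Kronecker set $E\subset\mathbb{T}$, and let $M_z$ be the multiplication operator on $L^2(\mathbb{T},\mu)$ given by $(M_zf)(z)=zf(z)$. Then the weak limit semigroup of $M_z$ coincides with the set of all contractions on $L^2(\mathbb{T},\mu)$ commuting with $M_z$, i.e. with the set of all multiplication operators $M_g$, $M_gf=gf$, with $g\in L^\infty(\mathbb{T},\mu)$ and $\|g\|_\infty\le 1$.
   Context: $\mathbb{T}$ is the unit circle in $\mathbb{C}$. A compact set $E\subset\mathbb{T}$ is a Kronecker set if the characters $z\mapsto z^n$, $n\in\mathbb{Z}$, restricted to $E$, are uniformly dense in the set of all continuous functions $E\to\mathbb{T}$. The weak limit semigroup of an operator $T$ is the set of operators $S$ such that $T^{n_k}\to S$ in the weak operator topology for some strictly increasing sequence $(n_k)$ in $\mathbb{N}$. *)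

(* Defs.v *)
From HB Require Import structures.
From mathcomp Require Import all_boot all_order all_algebra.
From mathcomp Require Import complex.
From mathcomp Require Import all_classical all_reals all_analysis.
From mathcomp Require Import measurable_realfun ess_sup_inf.

Set Implicit Arguments.
Unset Strict Implicit.
Unset Printing Implicit Defensive.

Import Order.TTheory GRing.Theory Num.Theory.
Import numFieldNormedType.Exports.
Import ComplexField.Normc.

Local Open Scope classical_set_scope.
Local Open Scope ring_scope.
Local Open Scope quotient_scope.

(* The usual topology and norm on the complex numbers: the library provides them
   on every [numFieldType], but not under the key [complex]. *)
HB.instance Definition _ (R : realType) := NormedModule.copy R[i] R[i]^o.
HB.instance Definition _ (R : realType) := PseudoPointedMetric.copy R[i] R[i]^o.

Section complex_measurability.
Context d (T : measurableType d) (R : realType).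
Implicit Types f g : T -> R[i].

(* Measurability and integration of complex functions are defined through the
   real and imaginary parts. *)
Definition cmeasurable f :=
  measurable_fun [set: T] (fun x => complex.Re (f x)) /\
  measurable_fun [set: T] (fun x => complex.Im (f x)).

Definition cintegral (mu : {measure set T -> \bar R}) f : R[i] :=
  Complex (\int[mu]_x complex.Re (f x)) (\int[mu]_x complex.Im (f x)).

Lemma normc_ReIm (z : R[i]) :
  normc z = Num.sqrt (complex.Re z ^+ 2 + complex.Im z ^+ 2).
Proof. by case: z. Qed.

Lemma normc_ge0 (z : R[i]) : 0 <= normc z.
Proof. by rewrite normc_ReIm sqrtr_ge0. Qed.

Lemma cmeasurable_normc f : cmeasurable f ->
  measurable_fun [set: T] (fun x => normc (f x)).
Proof.
move=> [mr mi]; under eq_fun do rewrite normc_ReIm.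
apply: (measurableT_comp (continuous_measurable_fun (@sqrt_continuous R))).
by apply: measurable_funD; exact: measurable_funX.
Qed.

Lemma cmeasurable_cst (a : R[i]) : cmeasurable (cst a).
Proof. by split; exact: measurable_cst. Qed.

Lemma cmeasurableD f g : cmeasurable f -> cmeasurable g ->
  cmeasurable (fun x => f x + g x).
Proof.
move=> [fr fi] [gr gi]; split.
- rewrite [X in measurable_fun _ X](_ : _ =
    (fun x => complex.Re (f x) + complex.Re (g x))); first exact: measurable_funD.
  by apply/funext => x; case: (f x) (g x) => [? ?] [? ?].
- rewrite [X in measurable_fun _ X](_ : _ =
    (fun x => complex.Im (f x) + complex.Im (g x))); first exact: measurable_funD.
  by apply/funext => x; case: (f x) (g x) => [? ?] [? ?].
Qed.

Lemma cmeasurableM f g : cmeasurable f -> cmeasurable g ->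
  cmeasurable (fun x => f x * g x).
Proof.
move=> [fr fi] [gr gi]; split.
- rewrite [X in measurable_fun _ X](_ : _ = (fun x =>
    complex.Re (f x) * complex.Re (g x) - complex.Im (f x) * complex.Im (g x))).
    by apply: measurable_funB; exact: measurable_funM.
  by apply/funext => x; case: (f x) (g x) => [? ?] [? ?].
- rewrite [X in measurable_fun _ X](_ : _ = (fun x =>
    complex.Re (f x) * complex.Im (g x) + complex.Im (f x) * complex.Re (g x))).
    by apply: measurable_funD; exact: measurable_funM.
  by apply/funext => x; case: (f x) (g x) => [? ?] [? ?].
Qed.

End complex_measurability.

(* The library's L^p spaces contain real-valued functions only. Here the
   library's [Lnorm] is applied to the modulus of a complex-valued function. *)
Section Lfun_complex.
Context d (T : measurableType d) (R : realType).
Variable mu : {measure set T -> \bar R}.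
Implicit Types (p : \bar R) (f g : T -> R[i]).

Definition cLnorm p f : \bar R := 'N[mu]_p[EFin \o (@normc R \o f)]%E.

Definition cLfun p : {pred T -> R[i]} :=
  mem [set f | cmeasurable f /\ (cLnorm p f < +oo)%E].

(* Elements of [Linfty] are essentially bounded functions rather than classes
   modulo a.e. equality; multiplication operators only depend on the class. *)
Record Linfty := MkLinfty {
  Linfty_fun :> T -> R[i];
  Linfty_prop : Linfty_fun \in cLfun +oo%E }.

Lemma Lfun2_dominated (h k : T -> R) :
  measurable_fun setT h -> k \in Lfun mu 2%:E ->
  (\forall x \ae mu, `|h x| <= `|k x|) -> h \in Lfun mu 2%:E.
Proof.
move=> mh + hk; rewrite !inE => /andP[/[!inE]/= mk].
have n0 : (2^-1 : R) != 0 by rewrite invr_eq0.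
rewrite /finite_norm [@Lnorm]unlock ; move=> kf; have kfin := lty_poweRy n0 kf.
apply/andP; split; rewrite inE//= /finite_norm [@Lnorm]unlock.
apply: poweR_lty; apply: le_lt_trans kfin.
have mabs (u : T -> R) : measurable_fun setT u ->
    measurable_fun setT (fun x => `|(EFin \o u) x| `^ 2)%E.
  move=> mu'; apply/measurable_EFinP.
  apply: (measurableT_comp (measurable_powR _)) => //.
  exact: measurableT_comp.
apply: ae_ge0_le_integral => //=.
- exact: mabs.
- exact: mabs.
- apply: filterS hk => x hkx _ /=.
  by rewrite lee_fin ge0_ler_powR// nnegrE.
Qed.

Lemma cLfun2P f : f \in cLfun 2%:E <->
  cmeasurable f /\ (fun x => normc (f x)) \in Lfun mu 2%:E.
Proof.
rewrite !inE; split => -[mf nf]; split => //.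
  apply/andP; split; rewrite inE//=; exact: cmeasurable_normc.
by case/andP: nf => _; rewrite inE.
Qed.

Lemma cLfun2_submod_closed : submod_closed (cLfun 2%:E).
Proof.
have [L0 LD] := @Lfun_submod_closed _ T R mu 2%:E (lee1n 2).
split=> [|a f g /cLfun2P[mf nf] /cLfun2P[mg ng]]; apply/cLfun2P.
  split; first exact: (cmeasurable_cst T (0 : R[i])).
  apply: (@Lfun2_dominated _ (cst 0)).
  - by apply: cmeasurable_normc; exact: (cmeasurable_cst T (0 : R[i])).
  - exact: L0.
  - by apply: nearW => x /=; rewrite expr0n/= addr0 sqrtr0.
have mafg : cmeasurable (a *: f + g).
  by apply: cmeasurableD => //; apply: cmeasurableM => //; exact: cmeasurable_cst.
split=> //; apply: (@Lfun2_dominated _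
    (normc a *: (fun x => normc (f x)) + (fun x => normc (g x)))).
- exact: cmeasurable_normc.
- exact: LD.
- apply: nearW => x /=.
  rewrite !ger0_norm ?addr_ge0 ?mulr_ge0 ?normc_ge0//.
  by rewrite (le_trans (le_normcD _ _))// normcM.
Qed.

HB.instance Definition _ :=
  GRing.isSubmodClosed.Build _ _ (cLfun 2%:E) cLfun2_submod_closed.

Lemma cLfun2M (g : Linfty) f : f \in cLfun 2%:E ->
  (fun x => g x * f x) \in cLfun 2%:E.
Proof.
case: g => g /=; rewrite inE => -[mg gy] /cLfun2P[mf nf].
have [_ LD] := @Lfun_submod_closed _ T R mu 2%:E (lee1n 2).
have [L0 _] := @Lfun_submod_closed _ T R mu 2%:E (lee1n 2).
have [M gM] : exists M, \forall x \ae mu, normc (g x) <= M.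
  move: gy; rewrite /cLnorm [@Lnorm]unlock; case: ifPn => [_|].
    move=> /ess_supr_bounded[M gM]; exists M; apply: filterS gM => x /=.
    exact: le_trans (ler_norm _).
  rewrite -leNgt measure_le0 => /eqP mu0 _.
  by exists 0; exact: measure0_ae.
apply/cLfun2P; split; first exact: cmeasurableM.
apply: (@Lfun2_dominated _ (M *: (fun x => normc (f x)) + 0)).
- by apply: cmeasurable_normc; exact: cmeasurableM.
- exact: LD.
- apply: filterS gM => x gxM.
  rewrite [X in _ <= `|X|](_ : _ = M * normc (f x)); last first.
    by rewrite /GRing.add/= /GRing.scale/= addr0.
  rewrite normcM normrM [leRHS]normrM ler_wpM2r//.
  rewrite ger0_norm ?normc_ge0//.
  exact: le_trans (ler_norm _).
Qed.

Record L2fun := MkL2fun {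
  L2fun_fun :> T -> R[i];
  L2fun_prop : L2fun_fun \in cLfun 2%:E }.

HB.instance Definition _ := [isSub for L2fun_fun].
HB.instance Definition _ := [Choice of L2fun by <:].
HB.instance Definition _ := [SubChoice_isSubLmodule of L2fun by <:].

Definition L2null : {pred L2fun} := mem [set f : L2fun | \forall x \ae mu, f x = 0].

Lemma L2null_zmod_closed : zmod_closed L2null.
Proof.
split=> [|f g]; rewrite !inE/=; first exact: aeW.
by apply: filterS2 => x fx gx; rewrite [LHS](_ : _ = f x - g x)// fx gx subrr.
Qed.

HB.instance Definition _ :=
  GRing.isZmodClosed.Build _ L2null L2null_zmod_closed.

End Lfun_complex.

Arguments L2null {d T R} mu.

Section L2.
Context d (T : measurableType d) (R : realType).
Variable mu : {measure set T -> \bar R}.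

(* Square-integrable functions modulo a.e. equality. *)
Definition L2 : Type := Quotient.quot (L2null mu).

HB.instance Definition _ := GRing.Zmodule.on L2.
HB.instance Definition _ := EqQuotient.on L2.

Definition L2_fun (f : L2) : T -> R[i] := L2fun_fun (repr f).

Lemma L2_eqP (f g : L2fun mu) :
  (\pi_L2 f = \pi_L2 g) <-> (f = g %[ae mu]).
Proof.
split.
  move=> /eqP; rewrite -Quotient.idealrBE inE/=.
  by apply: filterS => x fg _; apply/eqP; rewrite -subr_eq0; exact/eqP.
move=> fg; apply/eqP; rewrite -Quotient.idealrBE inE/=.
by apply: filterS fg => x /(_ I) fg; rewrite [LHS](_ : _ = f x - g x)// fg subrr.
Qed.

Lemma L2_repr (f : L2fun mu) : L2_fun (\pi_L2 f) = f %[ae mu].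
Proof. by apply/L2_eqP; rewrite reprK. Qed.

Definition L2_scale (a : R[i]) (f : L2) : L2 := \pi_L2 (a *: repr f).

Lemma L2_pi_scale a (f : L2fun mu) : L2_scale a (\pi_L2 f) = \pi_L2 (a *: f).
Proof.
apply/L2_eqP; apply: filterS (L2_repr f) => x /(_ I) fx _.
by congr (a * _).
Qed.

Lemma L2_piD (f g : L2fun mu) : \pi_L2 (f + g) = \pi_L2 f + \pi_L2 g.
Proof. exact: (Quotient.pi_add (L2null mu)). Qed.

Let L2_scaleA a b f : L2_scale a (L2_scale b f) = L2_scale (a * b) f.
Proof.
by elim/quotW: f => f; rewrite (L2_pi_scale b f) !L2_pi_scale scalerA.
Qed.

Let L2_scale1 : left_id 1 L2_scale.
Proof. by elim/quotW => f; rewrite L2_pi_scale scale1r. Qed.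

Let L2_scaleDr : right_distributive L2_scale +%R.
Proof.
move=> a; elim/quotW => f; elim/quotW => g.
by rewrite -L2_piD !L2_pi_scale -L2_piD scalerDr.
Qed.

Let L2_scaleDl f : {morph L2_scale^~ f : a b / a + b}.
Proof.
by move=> a b; elim/quotW: f => f; rewrite !L2_pi_scale -L2_piD scalerDl.
Qed.

HB.instance Definition _ := GRing.Zmodule_isLmodule.Build R[i] L2
  L2_scaleA L2_scale1 L2_scaleDr L2_scaleDl.

Definition L2norm (f : L2) : R := fine (cLnorm mu 2%:E (L2_fun f)).

Definition L2dot (f g : L2) : R[i] :=
  cintegral mu (fun x => L2_fun f x * (L2_fun g x)^*%C).

Definition mulop (g : Linfty mu) (f : L2) : L2 :=
  \pi_L2 (MkL2fun (cLfun2M g (L2fun_prop (repr f)))).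

Lemma L2_fun_mulop (g : Linfty mu) (f : L2) :
  L2_fun (mulop g f) = (fun x => g x * L2_fun f x) %[ae mu].
Proof. exact: L2_repr. Qed.

Lemma L2_funP (f g : L2) : f = g <-> L2_fun f = L2_fun g %[ae mu].
Proof. by rewrite -{1}[f]reprK -{1}[g]reprK; exact: L2_eqP. Qed.

Lemma L2_funZD a (f g : L2) :
  L2_fun (a *: f + g) = (fun x => a * L2_fun f x + L2_fun g x) %[ae mu].
Proof.
have -> : a *: f + g = \pi_L2 (a *: repr f + repr g).
  by rewrite L2_piD -L2_pi_scale !reprK.
exact: L2_repr.
Qed.

Lemma mulop_linear (g : Linfty mu) : linear (mulop g).
Proof.
move=> a f h; apply/L2_funP.
have Hl : L2_fun (mulop g (a *: f + h)) =
    (fun x => a * (g x * L2_fun f x) + g x * L2_fun h x) %[ae mu].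
  apply: filterS2 (L2_fun_mulop g (a *: f + h)) (L2_funZD a f h).
  by move=> x /(_ I) -> /(_ I) -> _; rewrite mulrDr mulrCA.
apply: filterS2 Hl (filterI (L2_funZD a (mulop g f) (mulop g h))
  (filterI (L2_fun_mulop g f) (L2_fun_mulop g h))).
by move=> x /(_ I) -> [/(_ I) -> [/(_ I) -> /(_ I) ->]] _.
Qed.

HB.instance Definition _ (g : Linfty mu) :=
  GRing.isLinear.Build R[i] L2 L2 *:%R (mulop g) (mulop_linear g).

Definition bounded_operator (S : L2 -> L2) :=
  exists C : R, forall f, L2norm (S f) <= C * L2norm f.

Definition L2contraction (S : L2 -> L2) := forall f, L2norm (S f) <= L2norm f.

(* Convergence in the weak operator topology of the Hilbert space [L2]. *)
Definition wot_cvg (A : nat -> L2 -> L2) (S : L2 -> L2) :=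
  forall f g, (fun k => L2dot (A k f) g) @ \oo --> L2dot (S f) g.

Definition weak_limit_semigroup (A : L2 -> L2) : set {linear L2 -> L2} :=
  [set S | bounded_operator S /\
     exists2 n : nat -> nat, {homo n : k l / (k < l)%N} &
       wot_cvg (fun k => iter (n k) A) S].

End L2.

Section circle.
Variable R : realType.

Definition circle : Type := set_type [set z : R[i] | `|z| = 1].

Definition circle_val (z : circle) : R[i] := set_val z.
Coercion circle_val : circle >-> complex.

HB.instance Definition _ := Uniform.on circle.

Let circle1 : (1 : R[i]) \in [set z : R[i] | `|z| = 1].
Proof. by rewrite inE/= normr1. Qed.

HB.instance Definition _ := isPointed.Build circle (exist _ 1 circle1).

Local Notation borel_circle := (g_sigma_algebraType (@open circle)).

Lemma normc_circle (z : circle) : normc z = 1.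
Proof. by have := set_valP z => /= -[]. Qed.

Lemma continuous_Re : continuous (@complex.Re R).
Proof.
move=> z; apply/(@cvgrPdist_lt _ _ _ (nbhs z)) => e e0.
apply/nbhs_ballP; exists e%:C%C; first by rewrite /= ltcR.
move=> w /= zwe; rewrite -ltcR; apply: le_lt_trans zwe.
by apply: le_trans (normc_ge_Re _); case: (z) (w) => [? ?] [? ?].
Qed.

Lemma continuous_Im : continuous (@complex.Im R).
Proof.
have ImE (z : R[i]) : complex.Im z = complex.Re (z * - 'i%C).
  by case: z => a b /=; rewrite !(mulr0, mul0r, oppr0, mulrN, mulr1) opprK add0r.
move=> z; rewrite (_ : @complex.Im R = @complex.Re R \o ( *%R^~ (- 'i%C))).
  apply: continuous_comp; last exact: continuous_Re.
  exact: (@mulrr_continuous R[i]).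
by apply/funext => w; exact: ImE.
Qed.

Lemma continuous_circle_val : continuous circle_val.
Proof. exact: initial_continuous. Qed.

Lemma measurable_continuous_circle (h : borel_circle -> R) :
  continuous (h : circle -> R) -> measurable_fun setT h.
Proof.
move=> /continuousP ch; apply: (measurability _ (RGenOpens.measurableE R)).
move=> _ [_ [a [b [-> <-]]]]; rewrite setTI; apply: sub_sigma_algebra.
exact/ch/interval_open.
Qed.

Lemma cmeasurable_circle_val : cmeasurable (circle_val : borel_circle -> R[i]).
Proof.
split; apply: measurable_continuous_circle => z;
  apply: continuous_comp; [exact: continuous_circle_val|exact: continuous_Re|
                           exact: continuous_circle_val|exact: continuous_Im].
Qed.

Lemma circle_val_Linfty (mu : {measure set borel_circle -> \bar R}) :
  circle_val \in cLfun mu +oo%E.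
Proof.
rewrite inE; split; first exact: cmeasurable_circle_val.
rewrite /cLnorm [@Lnorm]unlock; case: ifPn => // mu0.
apply: (@le_lt_trans _ _ 1%:E); last exact: ltry.
by apply/ess_supP/nearW => z /=; rewrite normc_circle normr1.
Qed.

(* Continuous maps from E to the circle are represented by maps that are
   continuous on the subspace E and arbitrary outside of E. *)
Definition kronecker_set (E : set circle) :=
  compact E /\
  forall f : circle -> circle, {within E, continuous f} ->
  forall e : R, 0 < e -> exists n : int, forall z : circle, E z ->
    normc ((z : R[i]) ^ n - (f z : R[i])) < e.

Definition mulz (mu : {measure set borel_circle -> \bar R}) :
    {linear L2 mu -> L2 mu} :=
  mulop (MkLinfty (circle_val_Linfty mu)).

End circle.

Notation borel_circle R := (g_sigma_algebraType (@open (circle R))).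

(* Main.v *)
(* By the Kronecker property, continuous unimodular functions on E are uniform
   limits of powers z^n with n arbitrarily large. A monotone class argument
   extends this, in the L^2 norm, to all measurable functions e^(i h), hence the
   powers z^n, n >= 0, span a dense subspace of L^2(mu).
   A contraction S commuting with M_z therefore is multiplication by S 1, and
   testing S on indicators gives |S 1| <= 1.
   Conversely write |g| <= 1 in polar form g = e^(i a) cos b, the mean of
   e^(i (a + b)) and e^(i (a - b)). Since mu is atomless, there are measurable
   signs s = +-1 nearly orthogonal to any finitely many bounded functions, so that
   e^(i (a + s b)) is weakly close to g; approximating it by powers z^n and
   testing on the matrix coefficients <z^n z^l, z^m> gives z^(n_k) -> g. *)

Require Import Defs.
From mathcomp Require Import all_boot all_order all_algebra complex.
From mathcomp Require Import all_classical all_reals all_analysis.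
From mathcomp Require Import measurable_realfun ess_sup_inf ring lra zify.
Import Order.TTheory GRing.Theory Num.Theory.
Import numFieldNormedType.Exports.
Import ComplexField.Normc.
Local Open Scope classical_set_scope.
Local Open Scope ring_scope.
Local Open Scope quotient_scope.

Set Implicit Arguments.
Unset Strict Implicit.
Unset Printing Implicit Defensive.

(** * Complex integrals and the Hilbert space L2 *)

(** The monotone class argument runs on the exponent h and not on e^(i h): a product of powers of z
    is again a power, so being approximable by powers is stable under sums of exponents, whereas
    unimodular functions do not form a vector space. The Kronecker property yields an exponent in Z
    without any control of its sign or size. Large natural exponents are gained by multiplying with
    a power of z that is uniformly close to 1 on E; such a power arises from approximating a
    constant close to 1 but different from it. The signs are built greedily. E is covered by
    finitely many sets of measure at most delta, and the sign on each new disjoint piece is chosen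
    against the integrals accumulated so far. The sum of the squares of all the integrals is then at
    most delta times the number of test functions. For a commuting contraction S, the function S 1
    is at first only known to lie in L^2, so f S 1 need not be square-integrable. The identity S f =
    f S 1 is therefore obtained in weak form, then for bounded f, and for all f only after the bound
    on |S 1|. *)

Section complex_facts.
Context {R : realType}.
Implicit Types z w : R[i].

Lemma Re_le_normc z : `|complex.Re z| <= normc z.
Proof.
rewrite normc_ReIm -[leLHS]sqrtr_sqr ler_wsqrtr// lerDl sqr_ge0//.
Qed.

Lemma Im_le_normc z : `|complex.Im z| <= normc z.
Proof.
rewrite normc_ReIm -[leLHS]sqrtr_sqr ler_wsqrtr// lerDr sqr_ge0//.
Qed.

Lemma normc_le_ReIm z : normc z <= `|complex.Re z| + `|complex.Im z|.
Proof.
rewrite normc_ReIm -[leRHS]ger0_norm ?addr_ge0// -[leRHS]sqrtr_sqr ler_wsqrtr//.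
rewrite sqrrD !real_normK ?num_real// addrAC lerDl mulrn_wge0// mulr_ge0//.
Qed.

Lemma sqr_normc z : normc z ^+ 2 = complex.Re z ^+ 2 + complex.Im z ^+ 2.
Proof. by rewrite normc_ReIm sqr_sqrtr// addr_ge0// sqr_ge0. Qed.

Lemma cReD z w : complex.Re (z + w) = complex.Re z + complex.Re w.
Proof. by case: z w => [? ?] []. Qed.

Lemma cImD z w : complex.Im (z + w) = complex.Im z + complex.Im w.
Proof. by case: z w => [? ?] []. Qed.

Lemma cReM z w : complex.Re (z * w) =
  complex.Re z * complex.Re w - complex.Im z * complex.Im w.
Proof. by case: z w => [? ?] []. Qed.

Lemma cImM z w : complex.Im (z * w) =
  complex.Re z * complex.Im w + complex.Im z * complex.Re w.
Proof. by case: z w => [? ?] []. Qed.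

Lemma normc_conjc z : normc z^*%C = normc z.
Proof. by case: z => a b; rewrite !normc_ReIm/= sqrrN. Qed.

Lemma mulc_conjc z : z * z^*%C = (normc z ^+ 2)%:C%C.
Proof.
rewrite sqr_normc; case: z => a b.
by apply/eqP; rewrite eq_complex/= mulrN opprK -!expr2 mulrN mulrC addNr !eqxx.
Qed.

Lemma conjcD z w : (z + w)^*%C = z^*%C + w^*%C.
Proof. exact: rmorphD. Qed.

Lemma conjcB z w : (z - w)^*%C = z^*%C - w^*%C.
Proof. exact: rmorphB. Qed.

Lemma conjcM z w : (z * w)^*%C = z^*%C * w^*%C.
Proof. exact: rmorphM. Qed.

Lemma normc_distC z w : normc (z - w) = normc (w - z).
Proof. by rewrite -normcN opprB. Qed.

Lemma normc_distD y z w : normc (z - w) <= normc (z - y) + normc (y - w).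
Proof. by rewrite (le_trans _ (le_normcD _ _))// addrA subrK. Qed.

Lemma normc_real (x : R) : normc x%:C%C = `|x|.
Proof. by rewrite normc_ReIm/= expr0n addr0 sqrtr_sqr. Qed.

End complex_facts.

Section complex_integral.
Context d (T : measurableType d) (R : realType).
Variable mu : {measure set T -> \bar R}.
Implicit Types (f g : T -> R[i]).

Definition cintegrable f :=
  mu.-integrable setT (EFin \o (fun x => complex.Re (f x))) /\
  mu.-integrable setT (EFin \o (fun x => complex.Im (f x))).

Lemma cmeasurable_conj f : cmeasurable f -> cmeasurable (fun x => (f x)^*%C).
Proof.
move=> [mr mi]; split.
  by apply: eq_measurable_fun mr => x _; case: (f x).
apply: (eq_measurable_fun (fun x => - complex.Im (f x))); last exact: measurableT_comp.
by move=> x _; case: (f x).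
Qed.

Lemma cmeasurable_real (h : T -> R) : measurable_fun setT h ->
  cmeasurable (fun x => (h x)%:C%C).
Proof. by move=> mh; split => //=; exact: measurable_cst. Qed.

Lemma cintegrableZ (a : R[i]) f : cintegrable f -> cintegrable (fun x => a * f x).
Proof.
move=> [fr fi]; split.
  have := integrableB measurableT (integrableZl measurableT (complex.Re a) fr)
     (integrableZl measurableT (complex.Im a) fi).
  by apply: eq_integrable => // x _ /=; rewrite cReM.
have := integrableD measurableT (integrableZl measurableT (complex.Re a) fi)
     (integrableZl measurableT (complex.Im a) fr).
by apply: eq_integrable => // x _ /=; rewrite cImM.
Qed.

Lemma cintegralD f g : cintegrable f -> cintegrable g ->
  cintegral mu (fun x => f x + g x) = cintegral mu f + cintegral mu g.
Proof.
move=> [fr fi] [gr gi]; rewrite /cintegral.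
under eq_Rintegral do rewrite cReD.
under [X in Complex _ X]eq_Rintegral do rewrite cImD.
by rewrite !RintegralD.
Qed.

Lemma rintegrableZ (r : R) (h : T -> R) : mu.-integrable setT (EFin \o h) ->
  mu.-integrable setT (EFin \o (fun x => r * h x)).
Proof. by move=> ih; apply: eq_integrable (integrableZl _ r ih). Qed.

Lemma cintegralZ (a : R[i]) f : cintegrable f ->
  cintegral mu (fun x => a * f x) = a * cintegral mu f.
Proof.
move=> [fr fi]; rewrite /cintegral.
under eq_Rintegral do rewrite cReM.
under [X in Complex _ X]eq_Rintegral do rewrite cImM.
rewrite RintegralB// ?RintegralD// ?RintegralZl//; try exact: rintegrableZ.
by case: a.
Qed.

Lemma cintegral_conj f : cintegrable f ->
  cintegral mu (fun x => (f x)^*%C) = (cintegral mu f)^*%C.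
Proof.
move=> [fr fi]; rewrite /cintegral /=; congr Complex.
  by apply: eq_Rintegral => x _; case: (f x).
rewrite -mulN1r -RintegralZl//.
by apply: eq_Rintegral => x _; rewrite mulN1r; case: (f x).
Qed.

Lemma ae_eq_cintegral f g : cmeasurable f -> cmeasurable g ->
  f = g %[ae mu] -> cintegral mu f = cintegral mu g.
Proof.
move=> [fr fi] [gr gi] fg; rewrite /cintegral; congr Complex; congr fine;
  apply: ae_eq_integral => //; try exact/measurable_EFinP.
- by apply: filterS fg => x /(_ I) -> _.
- by apply: filterS fg => x /(_ I) -> _.
Qed.

Lemma cLfun2_integrableM f g : f \in cLfun mu 2%:E -> g \in cLfun mu 2%:E ->
  cintegrable (fun x => f x * (g x)^*%C).
Proof.
move=> /cLfun2P[mf nf] /cLfun2P[mg ng].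
have /Lfun1_integrable ifg := Lfun2_mul_Lfun1 nf ng.
have [mr mi] := cmeasurableM mf (cmeasurable_conj mg).
split; apply: le_integrable ifg => //; try exact/measurable_EFinP.
- move=> x _ /=; rewrite lee_fin [leRHS]ger0_norm ?mulr_ge0 ?normc_ge0//.
  by rewrite (le_trans (Re_le_normc _))// normcM normc_conjc.
- move=> x _ /=; rewrite lee_fin [leRHS]ger0_norm ?mulr_ge0 ?normc_ge0//.
  by rewrite (le_trans (Im_le_normc _))// normcM normc_conjc.
Qed.

End complex_integral.

Section L2_hilbert.
Context d (T : measurableType d) (R : realType).
Variable mu : {measure set T -> \bar R}.
Implicit Types (f g h : L2 mu).

Definition mkL2 (f : T -> R[i]) (Hf : f \in cLfun mu 2%:E) : L2 mu :=
  \pi_(L2 mu) (MkL2fun Hf).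

Lemma mkL2E (f : T -> R[i]) (Hf : f \in cLfun mu 2%:E) :
  L2_fun (mkL2 Hf) = f %[ae mu].
Proof. exact: L2_repr. Qed.

Lemma L2_mem f : L2_fun f \in cLfun mu 2%:E.
Proof. exact: L2fun_prop. Qed.

Lemma L2_measurable f : cmeasurable (L2_fun f).
Proof. by have /cLfun2P[] := L2_mem f. Qed.

(** The representative [L2_fun f] of a class is an arbitrary choice; explicit inner products are
    computed by passing to convenient representatives here. *)
Lemma L2dotE f g (F G : T -> R[i]) : cmeasurable F -> cmeasurable G ->
  L2_fun f = F %[ae mu] -> L2_fun g = G %[ae mu] ->
  L2dot f g = cintegral mu (fun x => F x * (G x)^*%C).
Proof.
move=> mF mG fF gG; apply: ae_eq_cintegral.
- by apply: cmeasurableM; [|apply: cmeasurable_conj]; exact: L2_measurable.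
- by apply: cmeasurableM => //; apply: cmeasurable_conj.
- by apply: filterS2 fF gG => x /(_ I) -> /(_ I) ->.
Qed.

Lemma L2dotDZl (a : R[i]) f g h :
  L2dot (a *: f + g) h = a * L2dot f h + L2dot g h.
Proof.
have m := L2_measurable.
rewrite (@L2dotE _ h (fun x => a * L2_fun f x + L2_fun g x) (L2_fun h))//.
- under eq_fun do rewrite mulrDl -mulrA.
  rewrite cintegralD ?cintegralZ//.
  + by apply: cLfun2_integrableM; exact: L2_mem.
  + by apply: cintegrableZ; apply: cLfun2_integrableM; exact: L2_mem.
  + by apply: cLfun2_integrableM; exact: L2_mem.
- apply: cmeasurableD => //; apply: cmeasurableM => //; exact: cmeasurable_cst.
- exact: L2_funZD.
- exact: aeW.
Qed.

Lemma L2dotC f g : L2dot f g = (L2dot g f)^*%C.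
Proof.
rewrite /L2dot -cintegral_conj; last by apply: cLfun2_integrableM; exact: L2_mem.
congr cintegral; apply/funext => x.
by rewrite rmorphM/= conjcK mulrC.
Qed.

Lemma L2dotDl f g h : L2dot (f + g) h = L2dot f h + L2dot g h.
Proof. by rewrite -[f]scale1r L2dotDZl mul1r scale1r. Qed.

Lemma L2dot0l h : L2dot 0 h = 0.
Proof.
have := L2dotDl 0 0 h; rewrite addr0 => /eqP.
by rewrite -subr_eq subrr eq_sym => /eqP.
Qed.

Lemma L2dotZl a f h : L2dot (a *: f) h = a * L2dot f h.
Proof. by rewrite -[a *: f]addr0 L2dotDZl L2dot0l addr0. Qed.

Lemma L2dotBl f g h : L2dot (f - g) h = L2dot f h - L2dot g h.
Proof. by rewrite L2dotDl -scaleN1r L2dotZl mulN1r. Qed.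

Lemma L2dotDr f g h : L2dot h (f + g) = L2dot h f + L2dot h g.
Proof. by rewrite (L2dotC h) L2dotDl conjcD -!(L2dotC h). Qed.

Lemma L2dotZr a f h : L2dot h (a *: f) = a^*%C * L2dot h f.
Proof. by rewrite (L2dotC h) L2dotZl conjcM -(L2dotC h). Qed.

Lemma L2dotBr f g h : L2dot h (f - g) = L2dot h f - L2dot h g.
Proof. by rewrite (L2dotC h) L2dotBl conjcB -!(L2dotC h). Qed.

Lemma L2norm_ge0 f : 0 <= L2norm f.
Proof. by rewrite fine_ge0//; exact: Lnorm_ge0. Qed.

Lemma L2norm_fin f : cLnorm mu 2%:E (L2_fun f) \is a fin_num.
Proof.
rewrite ge0_fin_numE; last exact: Lnorm_ge0.
by have := L2_mem f; rewrite inE => -[].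
Qed.

Lemma L2norm_sqrE f (F : T -> R[i]) : cmeasurable F -> L2_fun f = F %[ae mu] ->
  ((L2norm f ^+ 2)%:E = \int[mu]_x (normc (F x) ^+ 2)%:E)%E.
Proof.
move=> mF fF; have -> : (L2norm f ^+ 2)%:E = (cLnorm mu 2%:E (L2_fun f) `^ 2)%E.
  rewrite -[in RHS](fineK (L2norm_fin f)) poweR_EFin.
  by rewrite -[2]/(2%:R) powR_mulrn// L2norm_ge0.
rewrite poweR_Lnorm//; apply: ge0_ae_eq_integral => //.
- move=> /=; apply/measurable_EFinP.
  apply: (measurableT_comp (measurable_powR _)) => //.
  apply: measurableT_comp => //; apply: cmeasurable_normc; exact: L2_measurable.
- apply/measurable_EFinP; apply: measurable_funX; exact: cmeasurable_normc.
- by move=> x _; rewrite lee_fin powR_ge0.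
- by move=> x _; rewrite lee_fin exprn_ge0// normc_ge0.
apply: filterS fF => x /(_ I) /= -> _.
by rewrite ger0_norm ?normc_ge0// powR_mulrn// normc_ge0.
Qed.

Lemma L2dot_norm f : L2dot f f = (L2norm f ^+ 2)%:C%C.
Proof.
rewrite /L2dot /cintegral; congr Complex.
  rewrite /Rintegral -[RHS]/(fine (L2norm f ^+ 2)%:E).
  rewrite (@L2norm_sqrE f (L2_fun f)) //; last exact: aeW.
    by congr fine; apply: eq_integral => x _; rewrite mulc_conjc.
  exact: L2_measurable.
under eq_Rintegral do rewrite mulc_conjc/=.
by rewrite Rintegral_cst// mul0r.
Qed.

Lemma L2norm0_eq0 f : L2norm f = 0 -> f = 0.
Proof.
(* The identity f + f = f characterises 0 and can be checked a.e. through [L2_funZD], without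
   knowing which representative the zero class has. *)
move=> f0; suff ff : 1 *: f + f = f.
  by apply: (addIr f); rewrite add0r -[X in X + _]scale1r.
have {}f0 : L2_fun f = cst 0 %[ae mu].
  have mf := cmeasurable_normc (L2_measurable f).
  have N0 : cLnorm mu 2%:E (L2_fun f) = 0%E.
    by rewrite -[LHS]fineK ?L2norm_fin//; congr EFin.
  have := Lnorm_eq0_eq0 _ _ N0; rewrite lte_fin ltr0n => /(_ _ isT) H.
  have {H} := H ltac:(exact/measurable_EFinP).
  apply: filterS => x /(_ I) /= [fx0] _.
  exact: eq0_normc.
apply/L2_funP; apply: filterS2 (L2_funZD 1 f f) f0 => x /(_ I) -> /(_ I) ->.
by rewrite /= addr0 mulr0.
Qed.

Lemma L2norm_sqr f : L2norm f ^+ 2 = complex.Re (L2dot f f).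
Proof. by rewrite L2dot_norm. Qed.

Lemma CauchySchwarz_L2 f g : normc (L2dot f g) <= L2norm f * L2norm g.
Proof.
have [g0|gN0] := eqVneq (L2norm g) 0.
  rewrite (L2norm0_eq0 g0) L2dotC L2dot0l conjc0.
  by rewrite normc0 mulr_ge0 ?L2norm_ge0.
have g_gt0 : 0 < L2norm g by rewrite lt0r gN0 L2norm_ge0.
(* [N *: f - c *: g] is the component of f orthogonal to g, multiplied by the squared norm of g to
   avoid a division. *)
set N := (L2norm g ^+ 2)%:C%C; set c := L2dot f g.
have /(congr1 (@complex.Re R)) : L2dot (N *: f - c *: g) (N *: f - c *: g) =
    N * (N * (L2norm f ^+ 2)%:C%C - (normc c ^+ 2)%:C%C).
  rewrite L2dotBl !L2dotBr !L2dotZl !L2dotZr !L2dot_norm -/N -/c -mulc_conjc.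
  by rewrite (L2dotC g f) -/c conjc_real; ring.
rewrite -L2norm_sqr => H.
have : 0 <= L2norm g ^+ 2 * (L2norm g ^+ 2 * L2norm f ^+ 2 - normc c ^+ 2).
  by move: (sqr_ge0 (L2norm (N *: f - c *: g))); rewrite H /N -rmorphM -rmorphB -rmorphM.
rewrite pmulr_rge0 ?exprn_gt0// subr_ge0 -exprMn => cg.
by rewrite mulrC -(@ler_pXn2r _ 2%N)// nnegrE ?mulr_ge0 ?normc_ge0 ?L2norm_ge0.
Qed.

Lemma L2normZ a f : L2norm (a *: f) = normc a * L2norm f.
Proof.
apply/eqP; rewrite -(@eqrXn2 _ 2%N)// ?mulr_ge0 ?normc_ge0 ?L2norm_ge0//.
apply/eqP/complexI; rewrite -L2dot_norm L2dotZl L2dotZr mulrA mulc_conjc.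
by rewrite L2dot_norm -rmorphM exprMn.
Qed.

Lemma L2normD f g : L2norm (f + g) <= L2norm f + L2norm g.
Proof.
rewrite -(@ler_pXn2r _ 2%N)// ?nnegrE ?addr_ge0 ?L2norm_ge0//.
rewrite L2norm_sqr L2dotDl !L2dotDr !cReD -!L2norm_sqr (L2dotC g f).
have -> : complex.Re ((L2dot f g)^*%C) = complex.Re (L2dot f g) by case: L2dot.
have := le_trans (le_trans (ler_norm _) (Re_le_normc _)) (CauchySchwarz_L2 f g).
by rewrite sqrrD; lra.
Qed.

Lemma L2norm_distC f g : L2norm (f - g) = L2norm (g - f).
Proof. by rewrite -opprB -scaleN1r L2normZ normcN normc1 mul1r. Qed.

Lemma L2dot_eq0 f : (forall g, L2dot f g = 0) -> f = 0.
Proof.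
move=> /(_ f); rewrite L2dot_norm => -[f0].
by apply: L2norm0_eq0; apply/eqP; rewrite -sqrf_eq0 f0.
Qed.

End L2_hilbert.

(** * Monotone classes of functions *)

Section functional_monotone_class.
Context d (T : measurableType d) (R : realType).
Variables (G : set (set T)) (P : (T -> R) -> Prop).
Hypothesis GE : @measurable _ T = <<s G >>.
Hypothesis GI : setI_closed G.
Hypothesis Pcst : forall a : R, P (cst a).
Hypothesis PG : forall (a : R) A, G A -> P (fun x => a * \1_A x).
Hypothesis PD : forall f g, P f -> P g -> P (f \+ g).
Hypothesis Plim : forall (u : nat -> T -> R) f,
  (forall n, measurable_fun setT (u n)) -> (forall n, P (u n)) ->
  (forall x, u ^~ x @ \oo --> f x) -> P f.

Let Psum (I : Type) (s : seq I) (F : I -> T -> R) :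
  (forall i, P (F i)) -> P (fun x => \sum_(i <- s) F i x).
Proof.
move=> PF; elim: s => [|i s ih].
  by rewrite (_ : (fun _ => _) = cst 0)//; apply/funext => x; rewrite big_nil.
rewrite (_ : (fun _ => _) = F i \+ (fun x => \sum_(i <- s) F i x)).
  exact: PD.
by apply/funext => x; rewrite big_cons.
Qed.

(** P is stable under sums but not assumed stable under scaling, so the factor a is quantified
    inside the Dynkin induction; complements use the factor -a. *)
Let Pindic A : measurable A -> forall a, P (fun x => a * \1_A x).
Proof.
rewrite GE; move: A; apply: (dynkin_induction GE GI) => //.
- by move=> a; rewrite (_ : (fun _ => _) = cst a)//; apply/funext => x; rewrite indicT mulr1.
- by move=> A GA a; exact: PG.
- move=> A mA PA a.
  rewrite (_ : (fun _ => _) = cst a \+ (fun x => (- a) * \1_A x)).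
    exact: PD.
  apply/funext => x /=; rewrite !indicE in_setC.
  by case: (x \in A) => /=; lra.
- move=> F mF tF PF a.
  apply: (Plim (u := fun n x => \sum_(k <- iota 0 n) a * \1_(F k) x)).
  + move=> n; apply: measurable_sum => k.
    by apply: measurable_funM => //; exact: measurable_indic.
  + by move=> n; apply: Psum => k; exact: PF.
  (* The sets are disjoint, so at each point at most one term is nonzero and the partial sums are
     eventually constant. *)
  move=> x; apply: cvg_near_cst.
  have [[k _ Fkx]|nFx] := pselect ((\bigcup_k F k) x).
    exists k.+1 => // n /= kn.
    rewrite (bigD1_seq k) ?iota_uniq ?mem_iota//=.
    rewrite big1 ?addr0 => [|i ik]; rewrite !indicE.
      by rewrite (mem_set Fkx) mem_set//; exists k.
    rewrite memNset ?mulr0// => Fix.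
    move: tF => /trivIsetP /(_ i k I I ik).
    by move/seteqP => [/(_ x)] => /(_ (conj Fix Fkx)).
  apply: nearW => n; rewrite big1 => [|k _]; rewrite indicE memNset ?mulr0//.
  by move=> Fkx; apply: nFx; exists k.
Qed.

Import HBNNSimple.

Let Pnnsfun (a : R) (h : {nnsfun T >-> R}) : P (fun x => a * h x).
Proof.
have fr : finite_set (range h) by exact: fimfunP.
rewrite (_ : (fun _ => _) = fun x =>
  \sum_(y <- finmap.enum_fset (fset_set (range h))) (a * y) * \1_(h @^-1` [set y]) x).
  by apply: Psum => y; apply: Pindic.
apply/funext => x; rewrite fimfunE fsbig_finite// mulr_sumr.
by apply: eq_bigr => y _; rewrite mulrA.
Qed.

Let Pnonneg (a : R) (h : T -> R) : measurable_fun setT h ->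
  (forall x, 0 <= h x) -> P (fun x => a * h x).
Proof.
move=> mh h0; have /measurable_EFinP mh' := mh.
apply: (Plim (u := fun n x => a * nnsfun_approx measurableT mh' n x)).
- by move=> n; apply: measurable_funM.
- by move=> n; exact: Pnnsfun.
move=> x; apply: cvgMr.
have /fine_cvg : EFin \o (nnsfun_approx measurableT mh')^~ x @ \oo --> (h x)%:E.
  by apply: (cvg_nnsfun_approx measurableT mh') => // y _; rewrite lee_fin.
by [].
Qed.

(** Simple functions are finite sums of multiples of indicators, nonnegative functions are limits of
    simple ones, and h splits into its positive and negative parts. *)
Lemma functional_monotone_class (h : T -> R) : measurable_fun setT h -> P h.
Proof.
move=> mh; rewrite (_ : h = (fun x => 1 * h^\+ x) \+ (fun x => (-1) * h^\- x)).
  apply: PD; apply: Pnonneg => //.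
  - exact: measurable_funrpos.
  - exact: measurable_funrneg.
by apply/funext => x /=; rewrite mul1r mulN1r -[in LHS](funrposBneg h).
Qed.

End functional_monotone_class.

(** * Continuous functions as generators of the measurable functions on the circle *)

Section open_indicator.
Context {R : realType}.
Local Notation circle := (circle R).

Lemma open_circleP (U : set circle) z : open U -> U z ->
  exists2 e : R, 0 < e & forall w : circle, normc (circle_val w - circle_val z) < e -> U w.
Proof.
case=> V oV <- /= Vz.
have : nbhs (circle_val z) V by exact: open_nbhs_nbhs.
move=> /nbhs_ballP[e /= e0 eV].
have [r e_r] : exists r, e = r%:C%C by apply/complex_realP; rewrite realE ltW.
exists r; first by rewrite -ltcR -e_r.
move=> w wz; apply: eV => /=; rewrite /ball/= e_r.
by rewrite distrC ltcR.
Qed.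

(** The distance to the complement of U, capped at 1. The extra element 1 gives the infimum a
    meaning when U is the whole circle and keeps [1 - cdist U z] in [0, 1]. *)
Definition cdist (U : set circle) (z : circle) : R :=
  inf [set r | r = 1 \/
    exists2 w : circle, ~ U w & r = normc (circle_val z - circle_val w)].

Lemma cdist_has_inf U z :
  has_inf [set r | r = 1 \/
    exists2 w : circle, ~ U w & r = normc (circle_val z - circle_val w)].
Proof.
split; first by exists 1; left.
by exists 0 => r [->//|[w _ ->]]; exact: normc_ge0.
Qed.

Lemma cdist_ge0 U z : 0 <= cdist U z.
Proof.
apply: lb_le_inf; first by exists 1; left.
by move=> r [->//|[w _ ->]]; exact: normc_ge0.
Qed.

Lemma cdist_le1 U z : cdist U z <= 1.
Proof. by apply: ge_inf; [case: (cdist_has_inf U z)|left]. Qed.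

Lemma cdist_out U z : ~ U z -> cdist U z = 0.
Proof.
move=> Uz; apply/eqP; rewrite eq_le cdist_ge0 andbT.
apply: ge_inf; first by case: (cdist_has_inf U z).
by right; exists z; rewrite // subrr normc0.
Qed.

Lemma cdist_gt0 U z : open U -> U z -> 0 < cdist U z.
Proof.
move=> oU /(open_circleP oU)[e e0 eU].
apply: (@lt_le_trans _ _ (Num.min 1 e)); first by rewrite lt_min ltr01.
apply: lb_le_inf; first by exists 1; left.
move=> r [->|[w Uw ->]]; first by rewrite ge_min lexx.
rewrite ge_min; apply/orP; right; rewrite leNgt; apply/negP => we.
by apply: Uw; apply: eU; rewrite -normcN opprB.
Qed.

Lemma cdist_lip U (z w : circle) :
  cdist U z - cdist U w <= normc (circle_val z - circle_val w).
Proof.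
rewrite lerBlDl -lerBlDr; apply: lb_le_inf; first by exists 1; left.
move=> r [->|[v Uv ->]].
  by rewrite lerBlDr (le_trans (cdist_le1 _ _))// lerDl normc_ge0.
rewrite lerBlDr; apply: (@le_trans _ _ (normc (circle_val z - circle_val v))).
  apply: ge_inf; first by case: (cdist_has_inf U z).
  by right; exists v.
by rewrite [leRHS]addrC normc_distD.
Qed.

Lemma continuous_cdist U : continuous (cdist U).
Proof.
move=> z; apply/(@cvgrPdist_lt _ _ _ (nbhs z)) => e e0.
have : \forall w \near z, normc (circle_val z - circle_val w) < e.
  have /(@cvgrPdist_lt _ _ _ (nbhs z)) /(_ e%:C%C) := @continuous_circle_val R z.
  rewrite ltcR => /(_ e0); apply: filterS => w.
  by rewrite normc_def ltcR normc_ReIm.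
apply: filterS => w; apply: le_lt_trans.
rewrite ler_norml cdist_lip andbT lerNl opprB.
by rewrite (le_trans (cdist_lip _ _ _))// -normcN opprB.
Qed.

(** The base [1 - cdist U z] lies in [0, 1) when z is in U and equals 1 otherwise, so its powers
    tend to 0 or stay at 1. *)
Lemma open_indic_approx (U : set circle) z : open U ->
  (fun k => 1 - (1 - cdist U z) ^+ k) @ \oo --> (\1_U z : R).
Proof.
move=> oU; rewrite indicE; have [Uz|Uz] := pselect (U z).
  rewrite mem_set// -[X in _ --> X]subr0; apply: cvgB; first exact: cvg_cst.
  apply: cvg_expr; rewrite ger0_norm ?subr_ge0 ?cdist_le1//.
  by rewrite gtrDl oppr_lt0 cdist_gt0.
rewrite memNset//; apply: cvg_near_cst; apply: nearW => k.
by rewrite cdist_out// subr0 expr1n subrr.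
Qed.

Lemma circle_monotone_class (P : (borel_circle R -> R) -> Prop) :
  (forall h : circle -> R, continuous h -> P h) ->
  (forall f g, P f -> P g -> P (f \+ g)) ->
  (forall (u : nat -> borel_circle R -> R) f,
    (forall n, measurable_fun setT (u n)) -> (forall n, P (u n)) ->
    (forall x, u ^~ x @ \oo --> f x) -> P f) ->
  forall h, measurable_fun setT h -> P h.
Proof.
move=> Pcont PD Plim h mh.
apply: (@functional_monotone_class _ (borel_circle R) R (@open circle) P) => //.
- by move=> A B; exact: openI.
- move=> a; apply: Pcont; exact: (@cst_continuous circle R a).
move=> a A oA.
have ck k : continuous (fun z : circle => a * (1 - (1 - cdist A z) ^+ k)).
  move=> z; apply: (@continuous_comp _ _ _ (cdist A)
    (fun x : R => a * (1 - (1 - x) ^+ k))); first exact: continuous_cdist.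
  apply: cvgMr; apply: cvgB; first exact: cvg_cst.
  apply: (@continuous_comp _ _ _ (fun x : R => 1 - x) (fun x : R => x ^+ k)).
    by apply: cvgB; [exact: cvg_cst|exact: cvg_id].
  exact: exprn_continuous.
apply: (Plim (fun k z => a * (1 - (1 - cdist A z) ^+ k))).
- by move=> k; apply: measurable_continuous_circle; exact: ck.
- by move=> k; apply: Pcont; exact: ck.
- by move=> z; apply: cvgMr; exact: open_indic_approx.
Qed.

End open_indicator.

(** * Powers of z approximating unimodular functions *)

Arguments normc : simpl never.
Arguments conjc : simpl never.

Section unit_exponential.
Context {R : realType}.
Local Notation circle := (circle R).
Implicit Types (t s : R) (z : circle).

Definition cexp t : R[i] := Complex (cos t) (sin t).

Lemma cexpD t s : cexp (t + s) = cexp t * cexp s.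
Proof.
apply/eqP; rewrite eq_complex/= cosD sinD eqxx addrC/=.
by rewrite [X in _ + X]mulrC eqxx.
Qed.

Lemma cexp0 : cexp 0 = 1.
Proof. by rewrite /cexp cos0 sin0. Qed.

Lemma normc_cexp t : normc (cexp t) = 1.
Proof. by rewrite normc_ReIm/= cos2Dsin2 sqrtr1. Qed.

Lemma cexp_dist t s :
  normc (cexp t - cexp s) <= `|cos t - cos s| + `|sin t - sin s|.
Proof. exact: normc_le_ReIm. Qed.

Lemma cvg_normc_cexp (F : set_system R) t : Filter F -> F --> t ->
  forall e : R, 0 < e -> \forall s \near F, normc (cexp t - cexp s) < e.
Proof.
move=> FF Ft e e0; have e20 : 0 < e / 2 by rewrite divr_gt0.
have /cvgrPdist_lt/(_ _ e20) ct : cos s @[s --> F] --> cos t.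
  by apply: continuous_cvg => //; exact: continuous_cos.
have /cvgrPdist_lt/(_ _ e20) st : sin s @[s --> F] --> sin t.
  by apply: continuous_cvg => //; exact: continuous_sin.
apply: filterS2 ct st => s cs ss.
by rewrite (le_lt_trans (cexp_dist _ _))// [ltRHS](splitr e) ltrD.
Qed.

Lemma cexp_near1 (e : R) : 0 < e -> exists t, 0 < normc (cexp t - 1) < e.
Proof.
move=> e0.
have : \forall s \near (0 : R), normc (cexp 0 - cexp s) < e.
  exact: (@cvg_normc_cexp (nbhs (0 : R)) 0 _ cvg_id e e0).
move=> /nbhs_ballP[d /= d0 dP].
(* The cap 1 keeps t in [0, pi], where cos is injective; hence [cexp t] differs from 1. *)
pose t := Num.min (d / 2) 1.
have t0 : 0 < t by rewrite lt_min divr_gt0//= ltr01.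
exists t; apply/andP; split; last first.
  rewrite normc_distC -cexp0; apply: dP; rewrite /ball/= sub0r normrN gtr0_norm//.
  by rewrite gt_min; apply/orP; left; lra.
rewrite lt_neqAle normc_ge0 andbT eq_sym.
apply/eqP => /eq0_normc/eqP; rewrite subr_eq0 -cexp0 => /eqP[ct _].
have : t = 0; last by move/eqP; rewrite gt_eqF.
have pi1 : 1 <= pi :> R by rewrite (le_trans _ (pi_ge2 _))// ler1n.
apply: cos_inj => //; rewrite in_itv/= ?lexx ?pi_ge0//.
by rewrite (ltW t0)/= (le_trans _ pi1)// ge_min lexx orbT.
Qed.

Lemma cexp_circle t : cexp t \in [set z : R[i] | `|z| = 1].
Proof. by rewrite inE/= normc_def -normc_ReIm normc_cexp. Qed.

Definition ucexp t : circle := exist _ (cexp t) (cexp_circle t).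

Lemma ucexpE t : circle_val (ucexp t) = cexp t.
Proof. by []. Qed.

Lemma continuous_ucexp (h : circle -> R) : continuous h -> continuous (ucexp \o h).
Proof.
move=> ch; apply/continuous_comp_initial => z.
apply/(@cvgrPdist_lt _ _ _ (nbhs z)) => e e0.
have [r e_r] : exists r, e = r%:C%C by apply/complex_realP; rewrite realE ltW.
rewrite e_r ltcR in e0 *.
have : \forall w \near z, normc (cexp (h z) - cexp (h w)) < r.
  have : \forall s \near h z, normc (cexp (h z) - cexp s) < r.
    exact: (@cvg_normc_cexp (nbhs (h z)) (h z) _ cvg_id r e0).
  exact: ch.
apply: filterS => w.
by rewrite -ltcR; apply: le_lt_trans; rewrite normc_def -normc_ReIm.
Qed.

Lemma circle_neq0 z : circle_val z != 0.
Proof.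
apply/eqP => z0; have := normc_circle z; rewrite z0 normc0 => /eqP.
by rewrite eq_sym oner_eq0.
Qed.

Lemma normcX (w : R[i]) n : normc (w ^+ n) = normc w ^+ n.
Proof. by elim: n => [|n ih]; rewrite ?expr0 ?normc1// !exprS normcM ih. Qed.

Lemma normc_circleX z (n : int) : normc (circle_val z ^ n) = 1.
Proof.
case: n => n; first by rewrite -exprnP normcX normc_circle expr1n.
by rewrite NegzE -exprnN normcV normcX normc_circle expr1n invr1.
Qed.

Lemma normc_expB1 (w : R[i]) k : normc w = 1 ->
  normc (w ^+ k - 1) <= normc (w - 1) *+ k.
Proof.
move=> w1; elim: k => [|k ih]; first by rewrite expr0 subrr normc0 mulr0n.
rewrite exprS (_ : w * w ^+ k - 1 = w * (w ^+ k - 1) + (w - 1)); last by ring.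
by rewrite (le_trans (le_normcD _ _))// normcM w1 mul1r mulrS [leRHS]addrC lerD2r.
Qed.

End unit_exponential.

Section kronecker_powers.
Context {R : realType}.
Local Notation circle := (circle R).
Variable E : set circle.
Hypothesis kE : kronecker_set E.

(** The constant [cexp t] is approximated to within its own distance from 1. This excludes the
    exponent 0 as soon as E has a point. The power found is close to 1 on E; raising it to the N.+1
    makes the exponent large and multiplies the error by at most N.+1, which is why the error starts
    at e / N.+1. *)
Lemma kronecker_large_id (e : R) (N : nat) : 0 < e ->
  exists2 m : nat, (N <= m)%N &
    forall z : circle, E z -> normc (circle_val z ^+ m - 1) < e.
Proof.
move=> e0; have [[z0 Ez0]|nE] := pselect (exists z, E z); last first.
  by exists N => // z Ez; exfalso; apply: nE; exists z.
have eN : 0 < e / N.+1%:R / 2 by rewrite !divr_gt0.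
have [t /andP[t0 te]] := cexp_near1 eN.
have ct : {within E, continuous (cst (ucexp t) : circle -> circle)}.
  by apply: continuous_subspaceT; exact: cst_continuous.
have [_ /(_ _ ct _ t0)[n nP]] := kE.
have n0 : n != 0.
  apply/eqP => n0; have := nP _ Ez0; rewrite n0 expr0z ucexpE normc_distC.
  by rewrite ltxx.
have zn z : E z -> normc (circle_val z ^ n - 1) < e / N.+1%:R.
  move=> Ez; rewrite (le_lt_trans (normc_distD (cexp t) _ _))//.
  rewrite [ltRHS](splitr (e / _)) ltrD//.
  by rewrite (lt_trans (nP _ Ez)).
(* A negative n may be replaced by its absolute value, since a unimodular number and its inverse are
   equally far from 1. *)
have {}zn z : E z -> normc (circle_val z ^+ `|n|%N - 1) < e / N.+1%:R.
  move=> /zn; case: (n) => // p; rewrite NegzE -exprnN => zp.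
  suff -> : normc (circle_val z ^+ p.+1 - 1) = normc (circle_val z ^- p.+1 - 1) by [].
  have zp0 : circle_val z ^+ p.+1 != 0 by rewrite expf_neq0// circle_neq0.
  rewrite normc_distC (_ : 1 - _ = circle_val z ^+ p.+1 * (circle_val z ^- p.+1 - 1)).
    by rewrite normcM normcX normc_circle expr1n mul1r.
  by rewrite mulrBr mulfV// mulr1.
exists (`|n| * N.+1)%N.
  by rewrite (leq_trans (leqnSn N))// leq_pmull// absz_gt0.
move=> z Ez; rewrite exprM; apply: le_lt_trans (normc_expB1 _ _) _.
  by rewrite normcX normc_circle expr1n.
by rewrite -mulr_natr -ltr_pdivlMr// zn.
Qed.

(** The integer exponent n given by the Kronecker property is shifted by some m at least N + |n| for
    which z^m is close to 1 on E, so that m + n is at least N. *)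
Lemma kronecker_nat (h : circle -> R) (e : R) (N : nat) : continuous h -> 0 < e ->
  exists2 n : nat, (N <= n)%N &
    forall z : circle, E z -> normc (circle_val z ^+ n - cexp (h z)) < e.
Proof.
move=> ch e0; have e20 : 0 < e / 2 by rewrite divr_gt0.
have cuh : {within E, continuous (ucexp \o h)}.
  by apply: continuous_subspaceT; exact: continuous_ucexp.
have [_ /(_ _ cuh _ e20)[n nP]] := kE.
have [m Nm mP] := kronecker_large_id (N + `|n|) e20.
exists `|(m%:Z + n)%R|%N; first by lia.
move=> z Ez.
have -> : circle_val z ^+ `|(m%:Z + n)%R|%N = circle_val z ^ n * circle_val z ^+ m.
  rewrite [LHS]exprnP gez0_abs; last by lia.
  by rewrite addrC expfzDr// circle_neq0.
rewrite (le_lt_trans (normc_distD (circle_val z ^ n) _ _))// [ltRHS](splitr e).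
apply: ltrD; last exact: nP.
by rewrite -[X in _ - X]mulr1 -mulrBr normcM normc_circleX mul1r mP.
Qed.

End kronecker_powers.

(** * Classes of explicit functions and multiplication operators *)

Section L2of.
Context d (T : measurableType d) (R : realType).
Variable mu : {measure set T -> \bar R}.
Implicit Types (F G : T -> R[i]) (f g : L2 mu) (m : Linfty mu).

(* The class of [F]; zero when [F] is not square-integrable. *)
Definition L2of F : L2 mu :=
  if pselect (F \in cLfun mu 2%:E) is left p then mkL2 p else 0.

Lemma L2ofE F : F \in cLfun mu 2%:E -> L2_fun (L2of F) = F %[ae mu].
Proof. by rewrite /L2of; case: pselect => // p _; exact: mkL2E. Qed.

Lemma L2of_fun f : L2of (L2_fun f) = f.
Proof. by apply/L2_funP; apply: L2ofE; exact: L2_mem. Qed.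

Lemma L2of_eqP F f : F \in cLfun mu 2%:E -> L2_fun f = F %[ae mu] -> f = L2of F.
Proof.
move=> F2 fF; apply/L2_funP; apply: filterS2 fF (L2ofE F2) => x /(_ I) ->.
by move=> /(_ I) ->.
Qed.

Lemma L2ofDZ a F G : F \in cLfun mu 2%:E -> G \in cLfun mu 2%:E ->
  L2of (fun x => a * F x + G x) = a *: L2of F + L2of G.
Proof.
move=> F2 G2; apply/esym/L2of_eqP.
  by have [_ /(_ a F G F2 G2)] := cLfun2_submod_closed mu.
apply: filterS2 (L2_funZD a (L2of F) (L2of G)) (filterI (L2ofE F2) (L2ofE G2)).
by move=> x /(_ I) -> [/(_ I) -> /(_ I) ->].
Qed.

Lemma L2_funB f g : L2_fun (f - g) = (fun x => L2_fun f x - L2_fun g x) %[ae mu].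
Proof.
rewrite addrC -scaleN1r; apply: filterS (L2_funZD (-1) g f) => x /(_ I) -> _.
by rewrite mulN1r addrC.
Qed.

Lemma L2_fun0 : L2_fun (0 : L2 mu) = cst 0 %[ae mu].
Proof.
have := L2_funB (0 : L2 mu) 0; rewrite [X in L2_fun X]subrr.
by apply: filterS => x /(_ I) ->; rewrite subrr.
Qed.

Lemma cLfun2Z a F : F \in cLfun mu 2%:E -> (fun x => a * F x) \in cLfun mu 2%:E.
Proof.
move=> F2; have [z0 /(_ a F 0 F2 z0)] := cLfun2_submod_closed mu.
by rewrite addr0.
Qed.

Lemma L2ofZ a F : F \in cLfun mu 2%:E -> L2of (fun x => a * F x) = a *: L2of F.
Proof.
move=> F2; apply/esym/L2of_eqP; first exact: cLfun2Z.
rewrite -[_ *: _]addr0.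
apply: filterS2 (L2_funZD a (L2of F) 0) (filterI (L2ofE F2) L2_fun0).
by move=> x /(_ I) -> [/(_ I) -> /(_ I) ->] _; rewrite addr0.
Qed.

Lemma mulop_L2of m F : F \in cLfun mu 2%:E ->
  mulop m (L2of F) = L2of (fun x => m x * F x).
Proof.
move=> F2; apply: L2of_eqP; first exact: cLfun2M.
apply: filterS2 (L2_fun_mulop m (L2of F)) (L2ofE F2) => x /(_ I) ->.
by move=> /(_ I) ->.
Qed.

Lemma mulop_comp m1 m2 m f : (forall x, m x = m1 x * m2 x) ->
  mulop m1 (mulop m2 f) = mulop m f.
Proof.
move=> mE; rewrite -(L2of_fun f) !mulop_L2of ?L2_mem//; last first.
  by apply: cLfun2M; exact: L2_mem.
by congr L2of; apply/funext => x; rewrite mE mulrA.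
Qed.

Lemma L2norm_le f g : (\forall x \ae mu, normc (L2_fun f x) <= normc (L2_fun g x)) ->
  L2norm f <= L2norm g.
Proof.
move=> fg; rewrite -(@ler_pXn2r _ 2%N) ?nnegrE ?L2norm_ge0// -lee_fin.
have mf h := L2_measurable h.
rewrite (@L2norm_sqrE _ _ _ _ f (L2_fun f))//; last exact: aeW.
rewrite (@L2norm_sqrE _ _ _ _ g (L2_fun g))//; last exact: aeW.
have msq h : measurable_fun setT (fun x => (normc (L2_fun h x : R[i]) ^+ 2)%:E).
  by apply/measurable_EFinP/measurable_funX/cmeasurable_normc.
apply: ae_ge0_le_integral => //.
- by move=> x _; rewrite lee_fin sqr_ge0.
- by move=> x _; rewrite lee_fin sqr_ge0.
by apply: filterS fg => x fg _; rewrite lee_fin ler_pXn2r// nnegrE normc_ge0.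
Qed.

Lemma mulop_contraction m : (\forall x \ae mu, normc (m x) <= 1) ->
  L2contraction (mulop m).
Proof.
move=> m1 f; apply: L2norm_le; apply: filterS2 (L2_fun_mulop m f) m1.
by move=> x /(_ I) -> mx1; rewrite normcM ler_piMl// normc_ge0.
Qed.

Lemma L2norm_dominated (F_ : nat -> T -> R[i]) F (g : T -> R) (e : R) :
  (forall n, F_ n \in cLfun mu 2%:E) -> F \in cLfun mu 2%:E ->
  (forall x, (fun n => normc (F_ n x - F x)) @ \oo --> (0 : R)) ->
  (forall n x, normc (F_ n x - F x) ^+ 2 <= g x) ->
  mu.-integrable setT (EFin \o g) -> 0 < e ->
  exists n, L2norm (L2of (F_ n) - L2of F) < e.
Proof.
move=> F_2 F2 cF domF ig e0.
have mF n : cmeasurable (fun x => F_ n x - F x).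
  have /cLfun2P[mFn _] := F_2 n; have /cLfun2P[mF _] := F2.
  under eq_fun do rewrite addrC -mulN1r.
  by apply: cmeasurableD => //; apply: cmeasurableM => //; exact: cmeasurable_cst.
have nE n : ((L2norm (L2of (F_ n) - L2of F) ^+ 2)%:E =
    \int[mu]_x (normc (F_ n x - F x) ^+ 2)%:E)%E.
  apply: L2norm_sqrE => //.
  apply: filterS2 (L2_funB (L2of (F_ n)) (L2of F)) (filterI (L2ofE (F_2 n)) (L2ofE F2)).
  by move=> x /(_ I) -> [/(_ I) -> /(_ I) ->].
have [] := @dominated_convergence _ _ _ mu setT measurableT
  (fun n x => (normc (F_ n x - F x) ^+ 2)%:E) (cst 0%E) (EFin \o g) _ _ _ ig.
- by move=> n; apply/measurable_EFinP/measurable_funX/cmeasurable_normc.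
- exact: measurable_cst.
- apply: aeW => x _; apply: cvg_EFin; first exact: nearW.
  by rewrite -[X in _ --> X](mulr0 (0 : R)); apply: cvgM; exact: cF.
- apply: aeW => x n _; rewrite /= lee_fin ger0_norm ?sqr_ge0//; exact: domF.
move=> _ _; rewrite integral0.
under eq_fun do rewrite -nE.
move=> /fine_cvg/cvgrPdist_lt/(_ (e ^+ 2)); rewrite exprn_gt0// => /(_ isT).
case=> n _ /(_ n (leqnn n)) /=.
rewrite sub0r normrN ger0_norm ?sqr_ge0// => ne; exists n.
by rewrite -(@ltr_pXn2r _ 2%N) ?nnegrE ?L2norm_ge0// ltW.
Qed.

End L2of.

Section unit_ball.
Context d (T : measurableType d) (R : realType).
Implicit Types (F G : T -> R[i]).

(** The bound holds everywhere, not only a.e., so that the polar form and the test functions involve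
    no exceptional set; [mulop_weak_limit] reduces the a.e. case to this one. *)
Definition unit_bounded F := cmeasurable F /\ forall x, normc (F x) <= 1.

Lemma unit_boundedM F G : unit_bounded F -> unit_bounded G ->
  unit_bounded (fun x => F x * G x).
Proof.
move=> [mF F1] [mG G1]; split; first exact: cmeasurableM.
by move=> x; rewrite normcM mulr_ile1// normc_ge0.
Qed.

Lemma unit_bounded1 : unit_bounded (cst 1).
Proof. by split=> [|x]; [exact: cmeasurable_cst|rewrite normc1]. Qed.

Lemma unit_bounded_conj F : unit_bounded F -> unit_bounded (fun x => (F x)^*%C).
Proof.
by move=> [mF F1]; split=> [|x]; [exact: cmeasurable_conj|rewrite normc_conjc].
Qed.

Lemma unit_bounded_cexp (h : T -> R) : measurable_fun setT h ->
  unit_bounded (cexp \o h).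
Proof.
move=> mh; split; last by move=> x /=; rewrite normc_cexp.
split; apply: measurableT_comp mh => //; apply: continuous_measurable_fun.
  exact: continuous_cos.
exact: continuous_sin.
Qed.

Variable mu : probability T R.

Lemma unit_bounded_cLnorm F : (\forall x \ae mu, normc (F x) <= 1) ->
  (cLnorm mu +oo%E F <= 1)%E.
Proof.
move=> F1; rewrite /cLnorm [@Lnorm]unlock; case: ifPn => // _.
apply/ess_supP; apply: filterS F1 => x /=.
by rewrite ger0_norm ?normc_ge0.
Qed.

Lemma cLnorm_unit_bounded F : (cLnorm mu +oo%E F <= 1)%E ->
  \forall x \ae mu, normc (F x) <= 1.
Proof.
(* The infinity norm takes a default value on measures of total mass 0; a probability is not one of
   them. *)
rewrite /cLnorm [@Lnorm]unlock; case: ifPn => [_|/negP[]]; last first.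
  by rewrite [X in (_ < X)%E](probability_setT mu) lte_fin.
move=> /ess_supP; apply: filterS => x /=.
by rewrite ger0_norm ?normc_ge0.
Qed.

Lemma Linfty_unit_bounded F : unit_bounded F -> F \in cLfun mu +oo%E.
Proof.
move=> [mF F1]; rewrite inE; split => //.
apply: (@le_lt_trans _ _ 1%E); last exact: ltry.
by apply: unit_bounded_cLnorm; exact: aeW.
Qed.

Lemma L2_bounded F c : cmeasurable F -> (forall x, normc (F x) <= c) ->
  F \in cLfun mu 2%:E.
Proof.
move=> mF Fc; apply/cLfun2P; split => //.
apply: (@Lfun2_dominated _ _ _ mu _ (cst c)).
- exact: cmeasurable_normc.
- exact: Lfun_cst.
- apply: nearW => x /=; rewrite !ger0_norm ?normc_ge0//.
  exact: le_trans (normc_ge0 _) (Fc x).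
Qed.

Lemma L2_unit_bounded F : unit_bounded F -> F \in cLfun mu 2%:E.
Proof. by case=> mF F1; exact: (L2_bounded mF F1). Qed.

Definition LinftyU F (uF : unit_bounded F) : Linfty mu :=
  MkLinfty (Linfty_unit_bounded uF).

Lemma L2norm_le_cst (f : L2 mu) (c : R) : 0 <= c ->
  (\forall x \ae mu, normc (L2_fun f x) <= c) -> L2norm f <= c.
Proof.
move=> c0 fc; rewrite -(@ler_pXn2r _ 2%N) ?nnegrE ?L2norm_ge0// -lee_fin.
have mf := L2_measurable f.
rewrite (@L2norm_sqrE _ _ _ _ f (L2_fun f))//; last exact: aeW.
apply: (@le_trans _ _ (\int[mu]_x (c ^+ 2)%:E)%E); last first.
  by rewrite integral_cst// [X in (_ * X)%E](probability_setT mu) mule1.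
apply: ae_ge0_le_integral => //.
- by move=> x _; rewrite lee_fin sqr_ge0.
- by apply/measurable_EFinP/measurable_funX/cmeasurable_normc.
- by move=> x _; rewrite lee_fin sqr_ge0.
by apply: filterS fc => x fx _; rewrite lee_fin ler_pXn2r// nnegrE normc_ge0.
Qed.

End unit_ball.

(** * Polar form of functions bounded by 1 *)

Section polar_decomposition.
Context {R : realType}.

(* [acos], extended by constants outside [-1, 1] to make it measurable on R. *)
Definition macos (t : R) : R :=
  (acos \_ `]-1, 1[%classic) t + pi * \1_`]-oo, (-1)%R]%classic t.

Lemma measurable_macos : measurable_fun setT macos.
Proof.
apply: measurable_funD.
  apply/(measurable_restrictT _ _).1 => //.
  apply: open_continuous_measurable_fun; first exact: interval_open.
  by move=> t; rewrite inE/= in_itv/= => t1; exact: continuous_acos.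
by apply: measurable_funM => //; exact: measurable_indic.
Qed.

Lemma macosE t : -1 <= t <= 1 -> macos t = acos t.
Proof.
move=> /andP[]; rewrite le_eqVlt => /predU1P[<- _|t1].
  rewrite /macos patchE memNset ?indicE ?mem_set ?mulr1 ?add0r ?acosN1//=.
    by rewrite in_itv/= lexx.
  by rewrite /= in_itv/= ltxx.
rewrite le_eqVlt => /predU1P[->|t2].
  rewrite /macos patchE memNset ?indicE ?memNset ?mulr0 ?addr0 ?acos1//=.
    by rewrite in_itv/=; apply/negP; rewrite -ltNge; lra.
  by rewrite in_itv/= ltxx andbF.
rewrite /macos patchE mem_set ?indicE ?memNset ?mulr0 ?addr0//=.
  by rewrite in_itv/=; apply/negP; rewrite -ltNge.
by rewrite in_itv/= t1.
Qed.

Lemma cos_macos t : -1 <= t <= 1 -> cos (macos t) = t.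
Proof. by move=> t1; rewrite macosE// acosK// in_itv. Qed.

Lemma sin_macos t : -1 <= t <= 1 -> sin (macos t) = Num.sqrt (1 - t ^+ 2).
Proof. by move=> t1; rewrite macosE// sin_acos. Qed.

Lemma cexp_cosM (a b : R) :
  cexp a * (cos b)%:C%C = 2^-1 * cexp (a + b) + 2^-1 * cexp (a - b).
Proof.
rewrite !cexpD -!mulrDr mulrCA; congr (_ * _).
have -> : cexp b + cexp (- b) = 2 * (cos b)%:C%C.
  rewrite mulr_natl mulr2n /cexp cosN sinN.
  by apply/eqP; rewrite eq_complex/= subrr addr0 !eqxx.
by rewrite mulrA mulVf ?mul1r// pnatr_eq0.
Qed.

Context d (T : measurableType d).

Lemma polar_decomposition (g : T -> R[i]) : unit_bounded g ->
  exists a b : T -> R, [/\ measurable_fun setT a, measurable_fun setT b &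
    forall x, g x = cexp (a x) * (cos (b x))%:C%C].
Proof.
move=> [mg g1]; have mn := cmeasurable_normc mg; have [mr mi] := mg.
(* [acos] only yields arguments in [0, pi]; the sign s reflects them for values in the lower half
   plane. *)
pose s x : R := 1 - 2 * \1_[set x | complex.Im (g x) < 0] x.
(* The cosine of the argument, with the inverse written as a real power so that [measurable_powR]
   applies. Where g vanishes its value is immaterial, because there cos b = |g| = 0. *)
pose c x := complex.Re (g x) * normc (g x) `^ (-1).
exists (fun x => s x * macos (c x)), (fun x => macos (normc (g x))); split.
- apply: measurable_funM.
    apply: measurable_funB => //; apply: measurable_funM => //.
    apply: measurable_indic; rewrite (_ : [set _ | _] =
      [set: T] `&` (fun y => complex.Im (g y)) @^-1` `]-oo, 0[%classic).
      exact: mi.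
    by rewrite setTI; apply/seteqP; split=> x /=; rewrite in_itv.
  apply: (measurableT_comp measurable_macos); apply: measurable_funM => //.
  exact: (measurableT_comp (measurable_powR _)).
- exact: (measurableT_comp measurable_macos).
move=> x; have n0 := normc_ge0 (g x).
rewrite cos_macos; last by rewrite (le_trans _ n0)//= lerN10.
have cE : c x = complex.Re (g x) / normc (g x) by rewrite /c powR_inv1.
have [gx0|gx0] := eqVneq (normc (g x)) 0.
  by rewrite gx0 mulr0; exact: eq0_normc.
have gx_gt0 : 0 < normc (g x) by rewrite lt_neqAle eq_sym gx0.
have c1 : -1 <= c x <= 1.
  rewrite -ler_norml cE normrM normfV (ger0_norm n0) ler_pdivrMr// mul1r.
  exact: Re_le_normc.
have sE : Num.sqrt (1 - c x ^+ 2) * normc (g x) = `|complex.Im (g x)|.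
  rewrite -{1}(ger0_norm n0) -(sqrtr_sqr (normc (g x))) -sqrtrM; last first.
    by rewrite subr_ge0 -ler_sqrt// sqrtr1 sqrtr_sqr ler_norml.
  rewrite -sqrtr_sqr cE; congr Num.sqrt.
  rewrite expr_div_n mulrBl mul1r divfK ?sqrf_eq0// sqr_normc.
  by rewrite [X in X - _]addrC addrK.
apply/eqP; rewrite eq_complex cReM cImM/= !mulr0 subr0 add0r.
rewrite /s indicE; have [Im0|Im0] := ltP (complex.Im (g x)) 0.
  rewrite mem_set// (_ : 1 - 2 * 1%:R = -1 :> R); last by lra.
  rewrite mulN1r cosN sinN cos_macos// sin_macos// cE divfK// eqxx/=.
  by rewrite mulNr -cE sE ltr0_norm// opprK.
rewrite memNset/=; last by rewrite ltNge Im0.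
rewrite mulr0 subr0 mul1r cos_macos// sin_macos// cE divfK// eqxx/=.
by rewrite -cE sE ger0_norm.
Qed.

End polar_decomposition.

(** * Density of the span of the nonnegative powers of z *)

Section density.
Context {R : realType}.
Variable mu : probability (borel_circle R) R.
Local Notation T := (borel_circle R).
Local Notation L2of := (L2of mu).

Definition zpow (n : nat) (z : T) : R[i] := circle_val z ^+ n.

Lemma unit_bounded_zpow n : unit_bounded (zpow n).
Proof.
elim: n => [|n ih].
  by rewrite (_ : zpow 0 = cst 1); [exact: unit_bounded1|apply/funext => z; rewrite /zpow expr0].
rewrite (_ : zpow n.+1 = fun z : T => circle_val z * zpow n z); last first.
  by apply/funext => z; rewrite /zpow exprS.
apply: unit_boundedM => //; split; first exact: cmeasurable_circle_val.
by move=> z; rewrite normc_circle.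
Qed.

Lemma zpow_L2 n : zpow n \in cLfun mu 2%:E.
Proof. by apply: L2_unit_bounded; exact: unit_bounded_zpow. Qed.

Lemma cexp_L2 (h : T -> R) : measurable_fun setT h -> cexp \o h \in cLfun mu 2%:E.
Proof. by move=> mh; apply: L2_unit_bounded; exact: unit_bounded_cexp. Qed.

Variable E : set (circle R).
Hypotheses (kE : kronecker_set E) (muE : mu (~` E) = 0%E).

(** The image of E in the plane is compact, hence closed, and E is its preimage because [circle_val]
    is injective. *)
Lemma kronecker_closed : closed E.
Proof.
have [cE _] := kE.
have cvE : closed (@circle_val R @` E).
  apply: compact_closed; first exact: (@norm_hausdorff _ R[i]).
  apply: continuous_compact => //.
  by apply: continuous_subspaceT; exact: continuous_circle_val.
rewrite (_ : E = @circle_val R @^-1` (@circle_val R @` E)).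
  by apply: preimage_closed => // z _; exact: continuous_circle_val.
apply/seteqP; split=> [z Ez|z [w Ew /val_inj <-]//].
by exists z.
Qed.

Lemma measurable_kronecker : measurable (E : set T).
Proof.
rewrite -[E]setCK; apply: measurableC; apply: sub_sigma_algebra.
exact/closed_openC/kronecker_closed.
Qed.

Lemma ae_kronecker (P : T -> Prop) : (forall z : circle R, E z -> P z) ->
  \forall z \ae mu, P z.
Proof.
move=> EP; exists (~` E); split => //.
  by apply: measurableC; exact: measurable_kronecker.
by apply: subsetC => z; exact: EP.
Qed.

Lemma cexp_approx (h : T -> R) : measurable_fun setT h ->
  forall (e : R) (N : nat), 0 < e -> exists2 n : nat, (N <= n)%N &
    L2norm (L2of (zpow n) - L2of (cexp \o h)) < e.
Proof.
(* Measurability is made part of the predicate because the closure steps receive nothing else about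
   their summands, and [L2of] is only meaningful on square-integrable functions. *)
move=> mh; suff [] : measurable_fun setT h /\
  forall (e : R) (N : nat), 0 < e -> exists2 n : nat, (N <= n)%N &
    L2norm (L2of (zpow n) - L2of (cexp \o h)) < e by [].
move: h mh; apply: circle_monotone_class.
- move=> h ch; have mh := measurable_continuous_circle ch.
  split=> // e N e0; have e20 : 0 < e / 2 by rewrite divr_gt0.
  have [n Nn nE] := kronecker_nat kE N ch e20.
  exists n => //; apply: (@le_lt_trans _ _ (e / 2)); last lra.
  apply: L2norm_le_cst; first exact: ltW.
  have mE : \forall z \ae mu, normc (zpow n z - cexp (h z)) < e / 2.
    exact: ae_kronecker.
  apply: filterS2 (L2_funB (L2of (zpow n)) (L2of (cexp \o h))) (filterI mE
    (filterI (L2ofE (zpow_L2 n)) (L2ofE (cexp_L2 mh)))).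
  by move=> z /(_ I) -> [/ltW zE [/(_ I) -> /(_ I) ->]].
- move=> f g [mf Pf] [mg Pg]; split; first exact: measurable_funD.
  move=> e N e0; have e20 : 0 < e / 2 by rewrite divr_gt0.
  have [n Nn nf] := Pf (e / 2) N e20; have [k _ kg] := Pg (e / 2) 0%N e20.
  exists (n + k)%N; first by rewrite (leq_trans Nn)// leq_addr.
  pose Mn := LinftyU mu (unit_bounded_zpow n).
  pose Mg := LinftyU mu (unit_bounded_cexp mg).
  (* Write z^(n+k) - e^(i(f+g)) as z^n (z^k - e^(ig)) + e^(ig) (z^n - e^(if)). Both multipliers are
     unimodular, so the errors add up, and only n has to be at least N. *)
  have -> : L2of (zpow (n + k)) - L2of (cexp \o (f \+ g)) =
      mulop Mn (L2of (zpow k) - L2of (cexp \o g)) +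
      mulop Mg (L2of (zpow n) - L2of (cexp \o f)).
    rewrite !raddfB/= !mulop_L2of ?zpow_L2 ?cexp_L2//.
    rewrite (_ : (fun x => Mn x * zpow k x) = zpow (n + k)); last first.
      by apply/funext => z; rewrite /= /zpow exprD.
    rewrite (_ : (fun x => Mg x * zpow n x) = (fun x => Mn x * (cexp \o g) x)).
      rewrite [X in _ = _ + (_ - L2of X)](_ : _ = cexp \o (f \+ g)).
        by rewrite addrA subrK.
      by apply/funext => z /=; rewrite cexpD mulrC.
    by apply/funext => z /=; rewrite mulrC.
  rewrite (le_lt_trans (L2normD _ _))// [ltRHS](splitr e) ltrD//.
    apply: le_lt_trans kg; apply: mulop_contraction; apply: aeW => x /=.
    by have [_ ] := unit_bounded_zpow n.
  apply: le_lt_trans nf; apply: mulop_contraction; apply: aeW => x /=.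
  by rewrite normc_cexp.
- move=> u f mPu Pu uf.
  have mu_ n : measurable_fun setT (u n) by have [] := Pu n.
  have mf : measurable_fun setT f.
    by apply: (measurable_fun_cvg mu_) => x _; exact: uf.
  split=> // e N e0; have e20 : 0 < e / 2 by rewrite divr_gt0.
  have [k ke] : exists k, L2norm (L2of (cexp \o u k) - L2of (cexp \o f)) < e / 2.
    (* Two unimodular numbers differ by at most 2, so 4 dominates the squared distances. *)
    apply: (@L2norm_dominated _ _ _ mu (fun k => cexp \o u k) _ (cst 4)) => //.
    + by move=> n; exact: cexp_L2.
    + exact: cexp_L2.
    + move=> x; apply/cvgrPdist_lt => r r0.
      have : \forall n \near \oo, normc (cexp (f x) - cexp (u n x)) < r.
        exact: cvg_normc_cexp (uf x) _ r0.
      apply: filterS => n /=; rewrite sub0r normrN ger0_norm ?normc_ge0//.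
      by rewrite normc_distC.
    + move=> n x /=; rewrite (_ : 4 = (1 + 1) ^+ 2); last by ring.
      rewrite ler_pXn2r ?nnegrE ?normc_ge0//.
      by rewrite (le_trans (le_normcD _ _))// normcN !normc_cexp.
    + exact: finite_measure_integrable_cst.
  have [_ /(_ (e / 2) N e20)[n Nn ne]] := Pu k.
  exists n => //; rewrite -(subrK (L2of (cexp \o u k)) (L2of (zpow n))) -addrA.
  by rewrite (le_lt_trans (L2normD _ _))// [ltRHS](splitr e) ltrD.
Qed.

(** Density in the form of an induction principle for closed subspaces V, which suits both the
    vanishing of a bounded functional and the convergence to 0 of a bounded sequence of
    functionals. *)
Lemma L2_density (V : L2 mu -> Prop) :
  (forall a f g, V f -> V g -> V (a *: f + g)) ->
  (forall f, (forall e : R, 0 < e -> exists2 h, V h & L2norm (f - h) < e) -> V f) ->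
  (forall n, V (L2of (zpow n))) -> forall f, V f.
Proof.
move=> VDZ Vcl Vz.
have V0 : V 0.
  by have := VDZ (-1) _ _ (Vz 0%N) (Vz 0%N); rewrite scaleN1r addNr.
have VZ a f : V f -> V (a *: f).
  by move=> Vf; rewrite -[_ *: _]addr0; exact: VDZ.
have Vcexp h : measurable_fun setT h -> V (L2of (cexp \o h)).
  move=> mh; apply: Vcl => e e0; have [n _ ne] := cexp_approx mh 0%N e0.
  by exists (L2of (zpow n)) => //; rewrite L2norm_distC.
(* By the polar form, g is half the sum of two functions [cexp \o h] with h measurable. *)
have Vunit g : unit_bounded g -> V (L2of g).
  move=> /polar_decomposition[a [b [ma mb gE]]].
  rewrite (_ : g = fun x => 2^-1 * (cexp \o (a \+ b)) x +
      2^-1 * (cexp \o (a \- b)) x); last first.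
    by apply/funext => x; rewrite gE cexp_cosM.
  rewrite L2ofDZ ?L2ofZ ?cLfun2Z//; try by apply: cexp_L2; exact: measurable_funB.
    apply: VDZ; last apply: VZ; apply: Vcexp; first exact: measurable_funD.
    exact: measurable_funB.
  by apply: cexp_L2; exact: measurable_funD.
move=> f; have mF := L2_measurable f.
have mn := cmeasurable_normc mF.
(* Truncation of f: on A n the function f, divided by n.+1, is bounded by 1. The shift by one keeps
   the divisor nonzero. *)
pose A n := [set x | normc (L2_fun f x) <= n.+1%:R].
have mA n : measurable (A n).
  rewrite (_ : A n = [set: T] `&` (fun x => normc (L2_fun f x)) @^-1`
    `]-oo, n.+1%:R]%classic); first exact: mn.
  by rewrite setTI; apply/seteqP; split=> x /=; rewrite in_itv.
pose G n x : R[i] := (\1_(A n) x : R)%:C%C * L2_fun f x.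
have Gf n x : normc (G n x) <= normc (L2_fun f x).
  rewrite normcM normc_real indicE; case: (x \in A n); rewrite ?normr1 ?mul1r//.
  by rewrite normr0 mul0r normc_ge0.
have Gn n x : normc (G n x) <= n.+1%:R.
  have [xA|xA] := pselect (A n x); first exact: le_trans (Gf n x) xA.
  by rewrite /G indicE memNset// mul0r normc0.
have mG n : cmeasurable (G n).
  by apply: cmeasurableM => //; apply: cmeasurable_real; exact: measurable_indic.
have G2 n : G n \in cLfun mu 2%:E by exact: (L2_bounded mu (mG n) (Gn n)).
have VG n : V (L2of (G n)).
  have nn0 : (n.+1%:R : R[i]) != 0 by rewrite pnatr_eq0.
  have uG : unit_bounded (fun x => n.+1%:R^-1 * G n x).
    split=> [|x]; first by apply: cmeasurableM => //; exact: cmeasurable_cst.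
    have -> : (n.+1%:R^-1 : R[i]) = (n.+1%:R^-1 : R)%:C%C.
      by rewrite fmorphV rmorph_nat.
    rewrite normcM normc_real ger0_norm ?invr_ge0//.
    by rewrite mulrC ler_pdivrMr// mul1r.
  rewrite (_ : G n = fun x => n.+1%:R * (n.+1%:R^-1 * G n x)).
    by rewrite L2ofZ ?cLfun2Z//; apply: VZ; exact: Vunit.
  by apply/funext => x; rewrite mulrA mulfV// mul1r.
apply: Vcl => e e0; have F2 := L2_mem f.
have [n ne] : exists n, L2norm (L2of (G n) - L2of (L2_fun f)) < e.
  apply: (@L2norm_dominated _ _ _ mu G _ (fun x => normc (L2_fun f x) ^+ 2)) => //.
  - move=> x; apply: cvg_near_cst.
    (* From the integer part of |f x| on, x lies in A n and the truncation agrees with f at x. *)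
    exists (Num.truncn (normc (L2_fun f x))) => // n /= xn.
    rewrite /G indicE mem_set ?mul1r ?subrr ?normc0// /A/=.
    rewrite ltW// (lt_le_trans (truncnS_gt _))// ler_nat ltnS//.
  - move=> n x; rewrite ler_pXn2r ?nnegrE ?normc_ge0//.
    have [xA|xA] := pselect (A n x).
      by rewrite /G indicE mem_set// mul1r subrr normc0 normc_ge0.
    by rewrite /G indicE memNset// mul0r sub0r normcN.
  - by apply: Lfun2_integrable_sqr; have /cLfun2P[] := F2.
by exists (L2of (G n)) => //; rewrite -[in f - _](L2of_fun f) L2norm_distC.
Qed.

End density.

(** * Contractions commuting with multiplication by z *)

Lemma linear_eq (R : pzRingType) (U V : lmodType R) (S S' : {linear U -> V}) :
  S =1 S' -> S = S'.
Proof.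
case: S S' => [f [[p] [q]]] [g [[p'] [q']]] /= /funext fg.
subst g; congr GRing.Linear.Pack.
by rewrite (Prop_irrelevance p p') (Prop_irrelevance q q').
Qed.

Section complex_limits.
Context {R : realType}.

(** The norm of [R[i]] takes its values in [R[i]]; this criterion uses real radii instead. *)
Lemma cvg_normcP (u : nat -> R[i]) (l : R[i]) : u @ \oo --> l <->
  forall e : R, 0 < e -> exists N, forall n, (N <= n)%N -> normc (l - u n) < e.
Proof.
split=> [/cvgrPdist_lt ul e e0|ul].
  have := ul e%:C%C; rewrite ltcR => /(_ e0)[N _ NP]; exists N => n Nn.
  by rewrite -ltcR; have := NP n Nn; rewrite normc_def -normc_ReIm.
apply/cvgrPdist_lt => e e0.
have [r e_r] : exists r, e = r%:C%C by apply/complex_realP; rewrite realE ltW.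
rewrite e_r ltcR in e0 *; have [N NP] := ul r e0.
by exists N => // n /NP; rewrite normc_def -normc_ReIm ltcR.
Qed.

Lemma cvg_normc_le (u : nat -> R[i]) (l : R[i]) (c : R) : u @ \oo --> l ->
  (forall n, normc (u n) <= c) -> normc l <= c.
Proof.
move=> /cvg_normcP ul uc; apply/ler_addgt0Pr => e e0.
have [N /(_ N (leqnn N)) Ne] := ul e e0.
rewrite -[l](subrK (u N)) addrC [leRHS]addrC.
by rewrite (le_trans (le_normcD _ _))// [leRHS]addrC lerD// ltW.
Qed.

End complex_limits.

Section multiplication_by_z.
Context {R : realType}.
Variable mu : probability (borel_circle R) R.
Local Notation T := (borel_circle R).
Local Notation L2of := (L2of mu).
Local Notation e_ n := (L2of (zpow n)).
Local Notation mulU uF := (mulop (LinftyU mu uF)).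
Local Notation Zn n := (mulop (LinftyU mu (unit_bounded_zpow n))).

Lemma iter_mulz n f : iter n (mulz mu) f = Zn n f.
Proof.
elim: n => [|n ih] /=.
  apply/L2_funP; apply: filterS (L2_fun_mulop (LinftyU mu (unit_bounded_zpow 0)) f).
  by move=> x /(_ I) -> /=; rewrite /zpow expr0 mul1r.
rewrite ih; apply: mulop_comp => x /=; exact: exprS.
Qed.

Lemma zpow_contraction n : L2contraction (Zn n).
Proof.
by apply: mulop_contraction; apply: aeW => x /=; have [_] := @unit_bounded_zpow R n.
Qed.

Lemma mulz_isometry f g : L2dot (mulz mu f) (mulz mu g) = L2dot f g.
Proof.
have mz := cmeasurable_circle_val R.
have mf h := L2_measurable (h : L2 mu).
rewrite (@L2dotE _ T R mu _ _ (fun x : T => circle_val x * L2_fun f x)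
  (fun x : T => circle_val x * L2_fun g x)); try exact: cmeasurableM; try exact: L2_fun_mulop.
congr cintegral; apply/funext => x.
by rewrite conjcM mulrACA mulc_conjc normc_circle expr1n mul1r.
Qed.

Lemma mulz_surj g : exists h, mulz mu h = g.
Proof.
have uz : unit_bounded (fun x : T => (circle_val x)^*%C).
  apply: unit_bounded_conj; split=> [|x]; first exact: cmeasurable_circle_val.
  by rewrite normc_circle.
exists (mulU uz g).
rewrite [LHS](@mulop_comp _ _ _ _ _ _ (LinftyU mu (unit_bounded_zpow 0))).
  by rewrite -iter_mulz.
by move=> x /=; rewrite /zpow mulc_conjc normc_circle expr1n.
Qed.

Lemma weak_limit_contraction_commute (S : {linear L2 mu -> L2 mu}) :
  weak_limit_semigroup (mulz mu) S ->
  L2contraction S /\ S \o mulz mu = mulz mu \o S.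
Proof.
move=> [_ [n _ nS]]; split.
  (* Weak convergence is tested against S f itself, which turns the bound on matrix coefficients
     into one on the norm. *)
  move=> f; have Sf : normc (L2dot (S f) (S f)) <= L2norm f * L2norm (S f).
    apply: (cvg_normc_le (nS f (S f))) => k.
    rewrite (le_trans (CauchySchwarz_L2 _ _))// ler_wpM2r ?L2norm_ge0//.
    by rewrite iter_mulz; exact: zpow_contraction.
  move: Sf; rewrite L2dot_norm normc_real ger0_norm ?sqr_ge0//.
  have := L2norm_ge0 (S f); rewrite le_eqVlt => /predU1P[<- _|S0].
    exact: L2norm_ge0.
  by rewrite expr2 ler_pM2r.
apply/funext => f /=; apply/eqP; rewrite -subr_eq0; apply/eqP.
apply: L2dot_eq0 => g; apply/eqP; rewrite L2dotBl subr_eq0; apply/eqP.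
(* With g = z h, the coefficients of z^(n_k) z f against z h equal those of z^(n_k) f against h. The
   limit is thus both <S (z f), g> and <S f, h> = <z S f, g>. *)
have [h hg] := mulz_surj g.
apply: (cvg_unique (@norm_hausdorff _ R[i]) (nS (mulz mu f) g)).
rewrite -hg mulz_isometry.
have zE k : L2dot (iter (n k) (mulz mu) (mulz mu f)) (mulz mu h) =
    L2dot (iter (n k) (mulz mu) f) h by rewrite -iterSr iterS mulz_isometry.
rewrite (_ : (fun k => L2dot _ _) =
  (fun k => L2dot (iter (n k) (mulz mu) f) h)); first exact: nS.
by apply/funext => k; exact: zE.
Qed.

Variable E : set (circle R).
Hypotheses (kE : kronecker_set E) (muE : mu (~` E) = 0%E).

Lemma functional_eq0 (D : L2 mu -> R[i]) (c : R) :
  (forall a f g, D (a *: f + g) = a * D f + D g) ->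
  (forall f, normc (D f) <= c * L2norm f) ->
  (forall n, D (e_ n) = 0) -> forall f, D f = 0.
Proof.
move=> DZ Dc; apply: (L2_density kE muE) => [a f g Df Dg|f fcl].
  by rewrite DZ Df Dg mulr0 addr0.
apply: eq0_normc; apply/eqP; rewrite eq_le normc_ge0 andbT.
apply/ler_addgt0Pr => e e0; rewrite add0r.
(* The sign of c is not known and c may vanish, hence the divisor |c| + 1. *)
have c1 : 0 < `|c| + 1 by rewrite ltr_wpDl.
have [h Dh fh] := fcl (e / (`|c| + 1)) (divr_gt0 e0 c1).
have -> : D f = D (f - h).
  by rewrite addrC -scaleN1r DZ Dh mulr0 add0r.
rewrite (le_trans (Dc _))// (@le_trans _ _ ((`|c| + 1) * L2norm (f - h)))//.
  by rewrite ler_wpM2r ?L2norm_ge0// (le_trans (ler_norm c))// lerDl.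
by rewrite mulrC -ler_pdivlMr// ltW.
Qed.

Lemma zpow_mulop n : e_ n = Zn n (e_ 0).
Proof.
rewrite mulop_L2of ?zpow_L2//; congr L2of; apply/funext => x /=.
by rewrite /zpow expr0 mulr1.
Qed.

Lemma commuting_zpow (S : {linear L2 mu -> L2 mu}) n f :
  S \o mulz mu = mulz mu \o S -> S (Zn n f) = Zn n (S f).
Proof.
move=> Sz; rewrite -!iter_mulz; elim: n => //= n <-.
exact: (congr1 (@^~ (iter n (mulz mu) f)) Sz).
Qed.

Lemma zpow_conj_L2 m (f : L2 mu) :
  (fun x => zpow m x * (L2_fun f x)^*%C) \in cLfun mu 2%:E.
Proof.
apply: (@cLfun2M _ _ _ mu (LinftyU mu (unit_bounded_zpow m))
  (fun x => (L2_fun f x)^*%C)).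
have /cLfun2P[mf nf] := L2_mem f; apply/cLfun2P; split.
  exact: cmeasurable_conj.
by under eq_fun do rewrite normc_conjc.
Qed.

(** The product of f and S 1 is only integrable, so S 1 is moved to the other side, where its
    conjugate meets the bounded z^m. For f = z^n both sides are the integral of z^n S 1 times the
    conjugate of z^m; both are bounded and linear in f. *)
Lemma commuting_dot (S : {linear L2 mu -> L2 mu}) : L2contraction S ->
  S \o mulz mu = mulz mu \o S -> forall f m,
  L2dot (S f) (e_ m) =
  L2dot f (L2of (fun x => zpow m x * (L2_fun (S (e_ 0)) x)^*%C)).
Proof.
move=> S1 Sz f m; set G := S (e_ 0).
have mz := @unit_bounded_zpow R.
have H2 := zpow_conj_L2 m G.
apply/eqP; rewrite -subr_eq0; apply/eqP.
set h := L2of (fun x => zpow m x * _).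
apply: (@functional_eq0 (fun f => L2dot (S f) (e_ m) - L2dot f h)
  (L2norm (e_ m) + L2norm h)) => {f} [a f g|f|n].
- by rewrite linearP !L2dotDZl; ring.
- rewrite (le_trans (le_normcD _ _))// normcN mulrDl lerD//.
    rewrite (le_trans (CauchySchwarz_L2 _ _))// mulrC ler_wpM2l ?L2norm_ge0//.
  by rewrite (le_trans (CauchySchwarz_L2 _ _))// mulrC.
apply/eqP; rewrite subr_eq0; apply/eqP.
rewrite zpow_mulop commuting_zpow// -/G -zpow_mulop.
have mG := L2_measurable G; have [mn _] := mz n; have [mm _] := mz m.
rewrite (@L2dotE _ T R mu _ _ (fun x => zpow n x * L2_fun G x) (zpow m))//.
- rewrite (@L2dotE _ T R mu _ _ (zpow n) (fun x => zpow m x * (L2_fun G x)^*%C))//.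
  + congr cintegral; apply/funext => x.
    by rewrite conjcM conjcK -!mulrA; congr (_ * _); rewrite mulrC.
  + by apply: cmeasurableM => //; exact: cmeasurable_conj.
  + by apply: L2ofE; exact: zpow_L2.
  + exact: L2ofE.
- exact: cmeasurableM.
- exact: L2_fun_mulop.
- by apply: L2ofE; exact: zpow_L2.
Qed.

Lemma L2dot_zpow_eq0 f : (forall m, L2dot f (e_ m) = 0) -> f = 0.
Proof.
move=> f0; apply: L2dot_eq0 => g.
suff gf : L2dot g f = 0 by rewrite L2dotC gf conjc0.
apply: (@functional_eq0 (fun g => L2dot g f) (L2norm f)) => {g} [a g h|g|n].
- exact: L2dotDZl.
- by rewrite (le_trans (CauchySchwarz_L2 _ _))// mulrC.
by rewrite L2dotC f0 conjc0.
Qed.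

Lemma commuting_bounded (S : {linear L2 mu -> L2 mu}) : L2contraction S ->
  S \o mulz mu = mulz mu \o S -> forall (F : T -> R[i]) (uF : unit_bounded F),
  S (L2of F) = mulU uF (S (e_ 0)).
Proof.
move=> S1 Sz F uF; apply/eqP; rewrite -subr_eq0; apply/eqP.
apply: L2dot_zpow_eq0 => m; apply/eqP; rewrite L2dotBl subr_eq0; apply/eqP.
rewrite commuting_dot//; set G := S (e_ 0).
have mz := @unit_bounded_zpow R.
have H2 := zpow_conj_L2 m G.
have mG := L2_measurable G; have [mF _] := uF; have [mm _] := mz m.
rewrite (@L2dotE _ T R mu _ _ F (fun x => zpow m x * (L2_fun G x)^*%C))//.
- rewrite (@L2dotE _ T R mu _ _ (fun x => F x * L2_fun G x) (zpow m))//.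
  + congr cintegral; apply/funext => x.
    by rewrite conjcM conjcK -!mulrA; congr (_ * _); rewrite mulrC.
  + exact: cmeasurableM.
  + exact: L2_fun_mulop.
  + by apply: L2ofE; exact: zpow_L2.
- by apply: cmeasurableM => //; exact: cmeasurable_conj.
- by apply: L2ofE; exact: L2_unit_bounded.
- exact: L2ofE.
Qed.

Lemma commuting_symbol_le1 (S : {linear L2 mu -> L2 mu}) : L2contraction S ->
  S \o mulz mu = mulz mu \o S ->
  \forall x \ae mu, normc (L2_fun (S (e_ 0)) x) <= 1.
Proof.
move=> S1 Sz; set G := S (e_ 0).
have mG := L2_measurable G; have mn := cmeasurable_normc mG.
pose A := [set x | 1 < normc (L2_fun G x)].
have mA : measurable A.
  rewrite (_ : A = [set: T] `&` (fun x => normc (L2_fun G x)) @^-1` `]1, +oo[%classic).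
    exact: mn.
  by rewrite setTI; apply/seteqP; split=> x /=; rewrite in_itv/= andbT.
pose F (x : T) := (\1_A x : R)%:C%C.
have mF : cmeasurable F by apply: cmeasurable_real; exact: measurable_indic.
have uF : unit_bounded F.
  by split=> // x; rewrite normc_real indicE; case: (_ \in _); rewrite ?normr1 ?normr0.
have : ((L2norm (mulU uF G) ^+ 2)%:E <= (L2norm (L2of F) ^+ 2)%:E)%E.
  rewrite lee_fin ler_pXn2r ?nnegrE ?L2norm_ge0//.
  by rewrite -(commuting_bounded S1 Sz).
have F2 := L2_unit_bounded mu uF.
have FG2 := cLfun2M (LinftyU mu uF) (L2_mem G).
rewrite (@L2norm_sqrE _ _ _ _ (mulU uF G) (fun x => F x * L2_fun G x)); last 2 first.
- exact: cmeasurableM.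
- exact: L2_fun_mulop.
rewrite (@L2norm_sqrE _ _ _ _ (L2of F) F)//; last exact: L2ofE.
have /cLfun2P[_ /Lfun2_integrable_sqr i1] := FG2.
have /cLfun2P[_ /Lfun2_integrable_sqr i2] := F2.
(* h is nonnegative, and positive exactly on A = {|G| > 1}. The contraction bound on the indicator
   of A makes its integral nonpositive, so A is negligible. *)
move=> le12; pose h (x : T) := normc (F x * L2_fun G x) ^+ 2 - normc (F x) ^+ 2.
have h_ge0 x : 0 <= h x.
  rewrite /h subr_ge0 normcM exprMn normc_real indicE.
  have [xA|xA] := pselect (A x); last by rewrite memNset// normr0 expr0n mul0r.
  by rewrite mem_set// normr1 expr1n mul1r exprn_ege1// ltW.
have h0 : (\int[mu]_x `|(h x)%:E| = 0)%E.
  apply/eqP; rewrite eq_le integral_ge0// andbT.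
  under eq_integral do rewrite gee0_abs ?lee_fin//.
  by rewrite integralB_EFin// sube_le0.
have mh : measurable_fun [set: T] (EFin \o h).
  by apply/measurable_EFinP; apply: measurable_funB; apply: measurable_funX;
    apply: cmeasurable_normc => //; exact: cmeasurableM.
have := (ae_eq_integral_abs mu measurableT mh).1 h0.
apply: filterS => x /(_ I) [hx]; rewrite leNgt; apply/negP => xA.
move: hx; rewrite /h normcM normc_real indicE (@mem_set _ A)// normr1 expr1n mul1r.
by move/eqP; rewrite subr_eq0 gt_eqF// exprn_egt1.
Qed.

(** Once |S 1| is at most 1 a.e., multiplication by S 1 is a bounded operator; it agrees with S on
    the powers of z, hence everywhere. *)
Lemma commuting_mulop (S : {linear L2 mu -> L2 mu}) : L2contraction S ->
  S \o mulz mu = mulz mu \o S ->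
  exists2 g : Linfty mu, (cLnorm mu +oo%E g <= 1)%E & S = mulop g.
Proof.
move=> S1 Sz; have G1 := commuting_symbol_le1 S1 Sz.
set G := S (e_ 0) in G1; have nG1 := unit_bounded_cLnorm G1.
have G_Loo : L2_fun G \in cLfun mu +oo%E.
  rewrite inE; split; first exact: L2_measurable.
  by apply: le_lt_trans nG1 _; exact: ltry.
exists (MkLinfty G_Loo) => //; apply: linear_eq => f.
have M1 := mulop_contraction (m := MkLinfty G_Loo) G1.
apply/eqP; rewrite -subr_eq0; apply/eqP; apply: L2dot_eq0 => g.
apply: (@functional_eq0 (fun f => L2dot (S f - mulop (MkLinfty G_Loo) f) g)
  (2 * L2norm g)) => {f} [a f h|f|n].
- rewrite -L2dotDZl; congr L2dot; rewrite linearP mulop_linear.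
  by rewrite scalerBr opprD addrACA.
- rewrite (le_trans (CauchySchwarz_L2 _ _))// mulrAC ler_wpM2r ?L2norm_ge0//.
  rewrite (le_trans (L2normD _ _))// mulr2n mulrDl mul1r lerD//.
  by rewrite -scaleN1r L2normZ normcN normc1 mul1r; exact: M1.
rewrite zpow_mulop commuting_zpow// -/G -zpow_mulop mulop_L2of ?zpow_L2//.
rewrite -[G in Zn n G]L2of_fun mulop_L2of ?L2_mem//.
rewrite (_ : (fun x => _) = (fun x : T => MkLinfty G_Loo x * zpow n x)).
  by rewrite subrr L2dot0l.
by apply/funext => x; rewrite /= mulrC.
Qed.

End multiplication_by_z.

(** * Almost orthogonal signs *)

Section small_covers.
Context {R : realType}.
Local Notation T := (borel_circle R).
Variable mu : probability T R.
Hypothesis mu_cont : forall z : circle R, mu [set z] = 0%E.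

Definition cball (z : circle R) (k : nat) : set (circle R) :=
  [set w | normc (circle_val w - circle_val z) < k.+1%:R^-1].

Lemma open_cball z k : open (cball z k).
Proof.
rewrite (_ : cball z k =
  @circle_val R @^-1` ball (circle_val z) (k.+1%:R^-1)%:C%C).
  by apply: open_comp => [w _|]; [exact: continuous_circle_val|exact: ball_open].
apply/seteqP; split=> w /=; rewrite /cball/= /ball/= distrC normc_def -normc_ReIm.
  by rewrite ltcR.
by rewrite ltcR.
Qed.

(** The balls of radius 1/(k+1) shrink to the null set {z}, and the finite measure is continuous
    from above. This is where atomlessness enters. *)
Lemma small_neighborhood (z : circle R) (e : R) : 0 < e ->
  exists U : set (circle R), [/\ open U, U z & (mu U < e%:E)%E].
Proof.
move=> e0.
have mc k : measurable (cball z k : set T).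
  by apply: sub_sigma_algebra; exact: open_cball.
have cap : \bigcap_k cball z k = [set z].
  apply/seteqP; split=> [w wz|w -> k _]; last by rewrite /cball/= subrr normc0 invr_gt0.
  apply/val_inj/eqP; rewrite -subr_eq0; apply/eqP/eq0_normc.
  apply/eqP; rewrite eq_le normc_ge0 andbT leNgt; apply/negP => wz0.
  have := wz (Num.truncn (normc (circle_val w - circle_val z))^-1) I.
  rewrite /cball/= ltNge => /negP; apply.
  by rewrite invf_ple ?posrE// ltW// truncnS_gt.
have : mu \o cball z @ \oo --> mu (\bigcap_k cball z k).
  apply: nonincreasing_cvg_mu => //.
  - by rewrite (le_lt_trans (probability_le1 _ _))// ltry.
  - exact: bigcapT_measurable.
  - move=> m n mn; apply/subsetPset => w; rewrite /cball/= => /lt_le_trans; apply.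
    by rewrite lef_pV2 ?posrE// ler_nat.
rewrite cap mu_cont => /fine_cvgP[_ /cvgrPdist_lt/(_ e e0)].
case=> n _ /(_ n (leqnn n)); rewrite /= sub0r normrN ger0_norm ?fine_ge0// => ne.
exists (cball z n); split; [exact: open_cball|by rewrite /cball/= subrr normc0 invr_gt0|].
by rewrite -[X in (X < _)%E]fineK ?fin_num_measure// lte_fin.
Qed.

Lemma small_cover (E : set (circle R)) (e : R) : compact E -> 0 < e ->
  exists (U : nat -> set T) (n : nat),
    [/\ forall i, measurable (U i), forall i, (mu (U i) <= e%:E)%E &
      E `<=` \big[setU/set0]_(i < n) U i].
Proof.
rewrite compact_cover => cE e0.
have [f fP] := choice (fun z => small_neighborhood z e0).
have [|z Ez|D' _ ED'] := cE (circle R) E f.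
- by move=> z _; have [] := fP z.
- by exists z => //; have [] := fP z.
pose s := finmap.enum_fset D'.
have mf z : measurable (f z : set T).
  by apply: sub_sigma_algebra; have [] := fP z.
(* Indices beyond the list return the neighbourhood of the default point, which is also measurable
   and small. *)
exists (fun i => f (nth point s i)), (size s); split => //.
- by move=> i; apply: ltW; have [] := fP (nth point s i).
move=> z /ED'[w /= wD' fwz]; rewrite -(bigcup_mkord (size s) (fun i => f (nth point s i))).
exists (index w s); first by rewrite /= index_mem.
by rewrite nth_index.
Qed.

End small_covers.

Section greedy_signs.
Context d (T : measurableType d) (R : realType).
Variable mu : probability T R.

Lemma bounded_integrable (f : T -> R) (c : R) : measurable_fun setT f ->
  (forall x, `|f x| <= c) -> mu.-integrable setT (EFin \o f).
Proof.
move=> mf fc; apply: (le_integrable measurableT _ _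
  (finite_measure_integrable_cst mu c measurableT)).
  exact/measurable_EFinP.
by move=> x _ /=; rewrite lee_fin (le_trans (fc x))// ler_norm.
Qed.

Variables (J : finType) (psi : J -> T -> R).
Hypothesis mpsi : forall j, measurable_fun setT (psi j).
Hypothesis psi1 : forall j x, `|psi j x| <= 1.

Let iM (r : T -> R) j : measurable_fun setT r -> (forall x, `|r x| <= 1) ->
  mu.-integrable setT (EFin \o (fun x => r x * psi j x)).
Proof.
move=> mr r1; apply: (@bounded_integrable _ 1); first exact: measurable_funM.
by move=> x; rewrite normrM mulr_ile1.
Qed.

Let indic_le1 (B : set T) x : `|\1_B x : R| <= 1.
Proof. by rewrite indicE; case: (x \in B); rewrite ?normr1 ?normr0. Qed.

Let int_indic_le (B : set T) j : measurable B ->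
  (\int[mu]_x (\1_B x * psi j x)) ^+ 2 <= fine (mu B) ^+ 2.
Proof.
move=> mB; rewrite -[leLHS]real_normK ?num_real// ler_pXn2r ?nnegrE ?fine_ge0//.
have mi : measurable_fun setT (\1_B : T -> R) by exact: measurable_indic.
rewrite (le_trans (le_normr_Rintegral measurableT (iM j mi (@indic_le1 B))))//.
have <- : \int[mu]_x \1_B x = fine (mu B).
  by rewrite /Rintegral integral_indic// setIT.
apply: le_Rintegral => //.
- exact: integrable_norm (iM j mi (@indic_le1 B)).
- exact: bounded_integrable mi (@indic_le1 B).
by move=> x _; rewrite normrM ger0_norm ?ler_piMr.
Qed.

(* When the sign of a new piece is chosen so that the cross term is nonpositive,
   the sum of squares grows by at most the sum of the squares of the integrals
   over this piece. *)
Lemma greedy_signs (U : nat -> set T) (e : R) n :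
  (forall i, measurable (U i)) -> (forall i, (mu (U i) <= e%:E)%E) ->
  let W := \big[setU/set0]_(i < n) U i in
  exists r : T -> R, [/\ measurable_fun setT r,
    forall x, W x -> r x = 1 \/ r x = -1, forall x, ~ W x -> r x = 0 &
    \sum_j (\int[mu]_x (r x * psi j x)) ^+ 2 <= #|J|%:R * e * fine (mu W)].
Proof.
move=> mU Ue; elim: n => [|n [r [mr r1 r0 re]]] W.
  exists (cst 0); split => //; first by rewrite /W big_ord0.
  rewrite /W big_ord0 measure0 mulr0 big1// => j _.
  under eq_Rintegral do rewrite mul0r.
  by rewrite Rintegral_cst// mul0r expr0n.
set W' := \big[setU/set0]_(i < n) U i in r1 r0 re.
have mW' : measurable W' by exact: bigsetU_measurable.
pose B := U n `\` W'; have mB : measurable B by exact: measurableD.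
have WE : W = W' `|` B.
  by rewrite /W big_ord_recr/= -/W' /B setDE setUIr setUCr setIT.
have W'B : W' `&` B = set0 by rewrite /B setDE setICA setICr setI0.
pose a j := \int[mu]_x (r x * psi j x); pose b j := \int[mu]_x (\1_B x * psi j x).
pose s : R := if \sum_j a j * b j <= 0 then 1 else -1.
have s2 : s ^+ 2 = 1 by rewrite /s; case: ifP; rewrite ?sqrrN expr1n.
have sab : s * \sum_j a j * b j <= 0.
  rewrite /s; case: ifPn => [|]; first by rewrite mul1r.
  by rewrite -ltNge mulN1r oppr_le0 => /ltW.
have rle1 x : `|r x| <= 1.
  have [/r1[]->|/r0->] := pselect (W' x); by rewrite ?normrN ?normr1 ?normr0.
have mi : measurable_fun setT (\1_B : T -> R) by exact: measurable_indic.
exists (fun x => r x + s * \1_B x); split.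
- by apply: measurable_funD => //; exact: measurable_funM.
- move=> x; rewrite WE => -[W'x|Bx].
    rewrite indicE memNset ?mulr0 ?addr0; first exact: r1.
    by move=> Bx; rewrite -[False]/(set0 x) -W'B.
  rewrite r0; last by case: Bx.
  by rewrite indicE mem_set// mulr1 add0r /s; case: ifP; [left|right].
- move=> x; rewrite WE => nWx; rewrite r0; last by move=> W'x; apply: nWx; left.
  by rewrite indicE memNset ?mulr0 ?addr0// => Bx; apply: nWx; right.
have intE j : \int[mu]_x ((r x + s * \1_B x) * psi j x) = a j + s * b j.
  under eq_Rintegral do rewrite mulrDl -mulrA.
  rewrite RintegralD//; last 2 first.
  - exact: iM.
  - by apply: rintegrableZ; exact: iM.
  by rewrite RintegralZl//; exact: iM.
under eq_bigr do rewrite intE.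
have -> : \sum_j (a j + s * b j) ^+ 2 =
    \sum_j a j ^+ 2 + (s * \sum_j a j * b j) *+ 2 + \sum_j b j ^+ 2.
  rewrite mulr_sumr -sumrMnl -!big_split/=; apply: eq_bigr => j _.
  by rewrite sqrrD exprMn s2 mul1r mulrCA.
have muW : fine (mu W) = fine (mu W') + fine (mu B).
  by rewrite WE measureU// fineD ?fin_num_measure.
rewrite muW mulrDr lerD//.
  by rewrite -[leRHS]addr0 lerD// mulrn_wle0.
(* Bounding mu(B)^2 by e mu(B) makes the increment linear in mu(B); since the pieces are disjoint,
   the increments add up to mu(W). *)
apply: (@le_trans _ _ (\sum_(j : J) e * fine (mu B))); last first.
  by rewrite sumr_const -[leRHS]mulrA mulr_natl.
apply: ler_sum => j _; rewrite (le_trans (int_indic_le j mB))// expr2 ler_wpM2r ?fine_ge0//.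
rewrite -lee_fin fineK ?fin_num_measure// (le_trans _ (Ue n))//.
by apply: le_measure; rewrite ?inE//; exact: subDsetl.
Qed.

End greedy_signs.

Section almost_orthogonal_signs.
Context {R : realType}.
Local Notation T := (borel_circle R).
Variable mu : probability T R.
Hypothesis mu_cont : forall z : circle R, mu [set z] = 0%E.
Variable E : set (circle R).
Hypotheses (cE : compact E) (mE : measurable (E : set T)).
Hypothesis muE : mu (~` E) = 0%E.

Lemma almost_orthogonal_signs (J : finType) (psi : J -> T -> R) (e : R) :
  (forall j, measurable_fun setT (psi j)) -> (forall j x, `|psi j x| <= 1) ->
  0 < e -> exists r : T -> R, [/\ measurable_fun setT r,
    forall x, r x = 1 \/ r x = -1 & forall j, `|\int[mu]_x (r x * psi j x)| <= e].
Proof.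
move=> mpsi psi1 e0.
(* With pieces of this size, the sum of squares is at most e^2 #|J| / (#|J| + 1). The successor
   covers an empty J. *)
have d0 : 0 < e ^+ 2 / #|J|.+1%:R by rewrite divr_gt0// exprn_gt0.
have [U [n [mU Ud EU]]] := small_cover mu_cont cE d0.
have [r [mr r1 r0 re]] := greedy_signs mpsi psi1 n mU Ud.
set W := \big[setU/set0]_(i < n) U i in EU r1 r0 re.
have mW : measurable W by exact: bigsetU_measurable.
(* Off W the greedy function is 0; it is set to 1 there, which leaves the integrals unchanged
   because W contains E. *)
exists (fun x => r x + \1_(~` W) x); split.
- by apply: measurable_funD => //; apply: measurable_indic; exact: measurableC.
- move=> x; rewrite indicE; have [Wx|Wx] := pselect (W x).
    by rewrite memNset ?addr0; [exact: r1|exact].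
  by rewrite mem_set// r0// add0r; left.
move=> j; rewrite -(@ler_pXn2r _ 2%N) ?nnegrE//; last exact: ltW.
rewrite real_normK ?num_real//.
have -> : \int[mu]_x ((r x + \1_(~` W) x) * psi j x) = \int[mu]_x (r x * psi j x).
  congr fine; apply: ae_eq_integral => //.
  - apply/measurable_EFinP/measurable_funM => //.
    by apply: measurable_funD => //; apply: measurable_indic; exact: measurableC.
  - exact/measurable_EFinP/measurable_funM.
  exists (~` W); split; first exact: measurableC.
    apply: (@subset_measure0 _ _ _ mu _ (~` E)) => //; try exact: measurableC.
    by apply: subsetC => x /EU.
  apply: subsetC => x Wx _; rewrite indicE memNset ?addr0//.
have {}re : \sum_j (\int[mu]_x (r x * psi j x)) ^+ 2 <= e ^+ 2.
  apply: le_trans re _.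
  rewrite (_ : _ * _ = e ^+ 2 * (#|J|%:R / #|J|.+1%:R * fine (mu W))); last by ring.
  rewrite ler_piMr ?sqr_ge0//.
  rewrite mulr_ile1 ?fine_ge0 ?divr_ge0//.
    by rewrite ler_pdivrMr// mul1r ler_nat.
  by rewrite -lee_fin fineK ?fin_num_measure// probability_le1.
apply: le_trans re; rewrite (bigD1 j)//= lerDl.
by apply: sumr_ge0 => i _; exact: sqr_ge0.
Qed.

End almost_orthogonal_signs.

(** * Weak limits of powers *)

Section weak_approximation.
Context {R : realType}.
Local Notation T := (borel_circle R).
Variable mu : probability T R.
Variable E : set (circle R).
Hypotheses (kE : kronecker_set E) (muE : mu (~` E) = 0%E).
Hypothesis mu_cont : forall z : circle R, mu [set z] = 0%E.
Local Notation L2of := (L2of mu).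
Local Notation e_ n := (L2of (zpow n)).
Local Notation mulU uF := (mulop (LinftyU mu uF)).
Local Notation Zn n := (mulop (LinftyU mu (unit_bounded_zpow n))).

Lemma L2norm_zpow_le1 n : L2norm (e_ n) <= 1.
Proof.
apply: L2norm_le_cst => //; apply: filterS (L2ofE (zpow_L2 mu n)) => x /(_ I) ->.
by have [_] := @unit_bounded_zpow R n.
Qed.

(* When the signs [s] are nearly orthogonal to the last factor, the second
   summand is negligible in the weak sense. *)
Lemma cexp_sign (a b s : R) : s = 1 \/ s = -1 ->
  cexp (a + s * b) =
  cexp a * (cos b)%:C%C + s%:C%C * ('i%C * (sin b)%:C%C * cexp a).
Proof.
move=> s1; rewrite cexpD.
have -> : cexp (s * b) = (cos b)%:C%C + s%:C%C * ('i%C * (sin b)%:C%C) :> R[i].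
  case: s1 => ->; rewrite ?mulN1r ?mul1r /cexp ?cosN ?sinN.
    by apply/eqP; rewrite eq_complex/=; apply/andP; split; apply/eqP; ring.
  by apply/eqP; rewrite eq_complex/=; apply/andP; split; apply/eqP; ring.
by rewrite mulrDr mulrC [X in _ + X]mulrC -!mulrA.
Qed.

Lemma weak_approx (F : T -> R[i]) (uF : unit_bounded F) (K N : nat) (e : R) :
  0 < e -> exists2 n : nat, (N <= n)%N & forall l m : nat, (l < K)%N -> (m < K)%N ->
  normc (L2dot (Zn n (e_ l)) (e_ m) - L2dot (mulU uF (e_ l)) (e_ m)) < e.
Proof.
move=> e0; have [a [b [ma mb FE]]] := polar_decomposition uF.
(* By [cexp_sign], the error of the matrix coefficient (l, m) is the integral of s times this
   kernel. The signs s must be nearly orthogonal to its real and imaginary parts for all l, m < K,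
   which are the finitely many psi. *)
pose kap l m z : R[i] := 'i%C * (sin (b z))%:C%C * cexp (a z) *
  (zpow l z * (zpow m z)^*%C).
have ukap l m : unit_bounded (kap l m).
  apply: unit_boundedM; last first.
    apply: unit_boundedM; first exact: unit_bounded_zpow.
    by apply: unit_bounded_conj; exact: unit_bounded_zpow.
  apply: unit_boundedM; last exact: unit_bounded_cexp.
  apply: unit_boundedM; split.
  - exact: cmeasurable_cst.
  - by move=> z; rewrite normc_ReIm/= expr0n expr1n add0r sqrtr1.
  - apply: cmeasurable_real; apply: measurableT_comp mb.
    by apply: continuous_measurable_fun; exact: continuous_sin.
  - by move=> z; rewrite normc_real ler_norml sin_geN1 sin_le1.
pose psi (j : bool * 'I_K * 'I_K) (z : T) : R :=
  let w := kap j.1.2 j.2 z in if j.1.1 then complex.Re w else complex.Im w.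
have mpsi j : measurable_fun setT (psi j).
  by case: j => -[[] l] m; have [[]] := ukap l m.
have psi1 j z : `|psi j z| <= 1.
  case: j => -[[] l] m; have [_ /(_ z) k1] := ukap l m.
    exact: le_trans (Re_le_normc _) k1.
  exact: le_trans (Im_le_normc _) k1.
(* Half of e is spent on replacing [cexp \o h] by a power of z, and a quarter on each of the real
   and imaginary parts of the sign error. *)
have e40 : 0 < e / 4 by rewrite divr_gt0.
have [cE _] := kE.
have [s [ms s1 sint]] := almost_orthogonal_signs mu_cont cE
  (measurable_kronecker kE) muE mpsi psi1 e40.
pose h x := a x + s x * b x.
have mh : measurable_fun setT h.
  by apply: measurable_funD => //; exact: measurable_funM.
have uh := unit_bounded_cexp mh.
have [n Nn ne] := cexp_approx kE muE mh N (divr_gt0 e0 (ltr0n R 2)).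
exists n => // l m lK mK.
have mz := @unit_bounded_zpow R.
have H1 : normc (L2dot (Zn n (e_ l)) (e_ m) - L2dot (mulU uh (e_ l)) (e_ m)) < e / 2.
  rewrite -L2dotBl.
  (* Factoring out z^l, a contraction, makes the bound independent of l and m. *)
  have -> : Zn n (e_ l) - mulU uh (e_ l) = Zn l (e_ n - L2of (cexp \o h)).
    rewrite raddfB/= !mulop_L2of ?zpow_L2 ?cexp_L2//; congr (L2of _ - L2of _);
      by apply/funext => z; rewrite mulrC.
  apply: le_lt_trans (CauchySchwarz_L2 _ _) _.
  rewrite (le_lt_trans (ler_piMr (L2norm_ge0 _) (L2norm_zpow_le1 m)))//.
  exact: le_lt_trans (zpow_contraction _ _) ne.
have H2 : normc (L2dot (mulU uh (e_ l)) (e_ m) - L2dot (mulU uF (e_ l)) (e_ m)) <= e / 2.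
  rewrite -L2dotBl.
  have [mF _] := uF; have [mH _] := uh.
  have [ml _] := mz l; have [mm _] := mz m.
  have mHF : cmeasurable (fun x => cexp (h x) - F x).
    under eq_fun do rewrite -[- _]mulN1r.
    by apply: cmeasurableD => //; apply: cmeasurableM => //; exact: cmeasurable_cst.
  rewrite (@L2dotE _ T R mu _ _ (fun x => (cexp (h x) - F x) * zpow l x) (zpow m))//.
  - rewrite (_ : (fun x => _) = fun x => (s x)%:C%C * kap l m x); last first.
      apply/funext => x; rewrite /h cexp_sign// FE [_ + _ - _]addrC addKr /kap.
      by rewrite -!mulrA.
    rewrite /cintegral (le_trans (normc_le_ReIm _))//=.
    have -> : e / 2 = e / 4 + e / 4 by lra.
    apply: lerD.
      rewrite (_ : Rintegral _ _ _ = \int[mu]_x (s x * psi (true, Ordinal lK, Ordinal mK) x)).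
        exact: sint.
      by apply: eq_Rintegral => x _; rewrite cReM/= mul0r subr0.
    rewrite (_ : Rintegral _ _ _ = \int[mu]_x (s x * psi (false, Ordinal lK, Ordinal mK) x)).
      exact: sint.
    by apply: eq_Rintegral => x _; rewrite cImM/= mul0r addr0.
  - exact: cmeasurableM.
  - apply: filterS2 (L2_funB (mulU uh (e_ l)) (mulU uF (e_ l)))
      (filterI (L2ofE (zpow_L2 mu l))
      (filterI (L2_fun_mulop (LinftyU mu uh) (e_ l)) (L2_fun_mulop (LinftyU mu uF) (e_ l)))).
    by move=> x /(_ I) -> [/(_ I) zl [/(_ I) -> /(_ I) ->]] _; rewrite zl mulrBl.
  - by apply: L2ofE; exact: zpow_L2.
rewrite (le_lt_trans (normc_distD (L2dot (mulU uh (e_ l)) (e_ m)) _ _))//.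
by rewrite [ltRHS](splitr e) ltr_leD.
Qed.

(** Only subadditivity of the modulus is required, so that the lemma applies to both arguments of
    the inner product, one linear and one conjugate-linear. The constant c is uniform in k, which
    makes the set of good f closed. *)
Lemma functional_cvg0 (D : nat -> L2 mu -> R[i]) (c : R) :
  (forall k a f g, normc (D k (a *: f + g)) <= normc a * normc (D k f) + normc (D k g)) ->
  (forall k f, normc (D k f) <= c * L2norm f) ->
  (forall n, D ^~ (e_ n) @ \oo --> (0 : R[i])) -> forall f, D ^~ f @ \oo --> (0 : R[i]).
Proof.
move=> DZ Dc; apply: (L2_density kE muE) => [a f g Df Dg|f fcl].
  apply/cvg_normcP => e e0.
  have a0 : 0 < normc a + 1 by rewrite ltr_wpDl ?normc_ge0.
  have [N1 N1P] := (cvg_normcP _ _).1 Df _ (divr_gt0 (divr_gt0 e0 (ltr0n R 2)) a0).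
  have [N2 N2P] := (cvg_normcP _ _).1 Dg _ (divr_gt0 e0 (ltr0n R 2)).
  exists (maxn N1 N2) => n; rewrite geq_max => /andP[/N1P + /N2P].
  rewrite !sub0r !normcN => Df1 Dg1.
  rewrite (le_lt_trans (DZ _ _ _ _))// [ltRHS](splitr e) ler_ltD//.
  apply: (@le_trans _ _ ((normc a + 1) * normc (D n f))).
    by rewrite ler_wpM2r ?normc_ge0// lerDl.
  by rewrite mulrC -ler_pdivlMr// ltW.
apply/cvg_normcP => e e0.
have c0 : 0 < `|c| + 1 by rewrite ltr_wpDl.
have [h Dh fh] := fcl _ (divr_gt0 (divr_gt0 e0 (ltr0n R 2)) c0).
have [N NP] := (cvg_normcP _ _).1 Dh _ (divr_gt0 e0 (ltr0n R 2)).
exists N => n /NP; rewrite !sub0r !normcN => Dh1.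
rewrite -[f](subrK h) -[f - h]scale1r (le_lt_trans (DZ _ _ _ _))//.
rewrite normc1 mul1r [ltRHS](splitr e) ler_ltD//.
rewrite (le_trans (Dc _ _))// (@le_trans _ _ ((`|c| + 1) * L2norm (f - h)))//.
  by rewrite ler_wpM2r ?L2norm_ge0// (le_trans (ler_norm c))// lerDl.
by rewrite mulrC -ler_pdivlMr// ltW.
Qed.

(** Density is used twice: to reduce f to powers of z for a fixed g, and then g for a fixed
    power. *)
Lemma weak_cvg_of_zpow (S_ : nat -> {linear L2 mu -> L2 mu}) (S : {linear L2 mu -> L2 mu}) :
  (forall k, L2contraction (S_ k)) -> L2contraction S ->
  (forall l m, (fun k => L2dot (S_ k (e_ l)) (e_ m) - L2dot (S (e_ l)) (e_ m)) @ \oo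
     --> (0 : R[i])) ->
  wot_cvg (fun k => S_ k) S.
Proof.
move=> S_1 S1 Sz f g; apply/cvg_normcP => e e0.
suff /cvg_normcP/(_ e e0)[N NP] :
    (fun k => L2dot (S_ k f) g - L2dot (S f) g) @ \oo --> (0 : R[i]).
  by exists N => n /NP; rewrite sub0r normcN normc_distC.
have bnd k u v : normc (L2dot (S_ k u) v - L2dot (S u) v) <= 2 * L2norm u * L2norm v.
  rewrite (le_trans (le_normcD _ _))// normcN -mulrA [leRHS]mulrDl mul1r.
  apply: lerD; apply: le_trans (CauchySchwarz_L2 _ _) _.
    by rewrite ler_wpM2r ?L2norm_ge0//; exact: S_1.
  by rewrite ler_wpM2r ?L2norm_ge0//; exact: S1.
apply: (@functional_cvg0 (fun k f => L2dot (S_ k f) g - L2dot (S f) g)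
  (2 * L2norm g)) => {f} [k a f h|k f|l].
- rewrite !linearP !L2dotDZl -normcM.
  by rewrite opprD addrACA -mulrBr le_normcD.
- by rewrite mulrAC; exact: bnd.
apply: (@functional_cvg0 (fun k g => L2dot (S_ k (e_ l)) g - L2dot (S (e_ l)) g)
  (2 * L2norm (e_ l))) => {g} [k a f h|k f|m].
- rewrite !L2dotDr !L2dotZr -(normc_conjc a) -normcM.
  by rewrite opprD addrACA -mulrBr le_normcD.
- exact: bnd.
exact: Sz.
Qed.

Lemma mulop_weak_limit (g : Linfty mu) : (cLnorm mu +oo%E g <= 1)%E ->
  weak_limit_semigroup (mulz mu) (mulop g).
Proof.
move=> /cLnorm_unit_bounded g1.
have gC : L2contraction (mulop g) := mulop_contraction g1.
split; first by exists 1 => f; rewrite mul1r; exact: gC.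
have [mg _] : cmeasurable g /\ (cLnorm mu +oo%E g < +oo)%E.
  by have := Linfty_prop g; rewrite inE.
pose A := [set x | normc (g x) <= 1].
have mA : measurable A.
  rewrite (_ : A = [set: T] `&` (fun x => normc (g x)) @^-1` `]-oo, 1]%classic).
    exact: (cmeasurable_normc mg).
  by rewrite setTI; apply/seteqP; split=> x /=; rewrite in_itv.
(* g is bounded by 1 only a.e.; setting it to 0 elsewhere gives the same operator and a bound at
   every point. *)
pose F x : R[i] := (\1_A x : R)%:C%C * g x.
have uF : unit_bounded F.
  split=> [|x].
    apply: cmeasurableM => //; apply: cmeasurable_real; exact: measurable_indic.
  rewrite /F indicE; have [xA|xA] := pselect (A x).
    by rewrite mem_set// mul1r.
  by rewrite memNset// mul0r normc0.
have gF f : mulop g f = mulU uF f.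
  apply/L2_funP.
  apply: filterS2 (filterI g1 (L2_fun_mulop g f)) (L2_fun_mulop (LinftyU mu uF) f).
  move=> x [gx1 /(_ I) ->] /(_ I) -> _ /=.
  by rewrite /F indicE mem_set// mul1r.
(* [p.1] fixes both the number of coefficients that are controlled and the precision; [p.2] is the
   lower bound on the exponent. *)
have /choice[phi phiP] (p : nat * nat) : exists n : nat, (p.2 <= n)%N /\
    forall l m : nat, (l < p.1)%N -> (m < p.1)%N ->
    normc (L2dot (Zn n (e_ l)) (e_ m) - L2dot (mulU uF (e_ l)) (e_ m)) < p.1.+1%:R^-1.
  have p0 : 0 < p.1.+1%:R^-1 :> R by rewrite invr_gt0.
  by have [n ? ?] := weak_approx uF p.1 p.2 p0; exists n.
(* A diagonal choice: the bound [(n k').+1] makes the sequence strictly increasing, and each pair l,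
   m is controlled at every stage k above both. *)
pose n := fix n k := if k is k'.+1 then phi (k, (n k').+1) else phi (0, 0)%N.
have nP k l m : (l < k)%N -> (m < k)%N ->
    normc (L2dot (Zn (n k) (e_ l)) (e_ m) - L2dot (mulU uF (e_ l)) (e_ m)) < k.+1%:R^-1.
  by case: k => // k; have [_] := phiP (k.+1, (n k).+1); exact.
exists n.
  apply: homo_ltn; first exact: ltn_trans.
  by move=> k; have [] := phiP (k.+1, (n k).+1).
have ZnC k := @zpow_contraction _ mu (n k).
move=> f h; under eq_fun do rewrite iter_mulz.
apply: (@weak_cvg_of_zpow (fun k => Zn (n k)) (mulop g) ZnC gC) => l m.
apply/cvg_normcP => e e0; exists (maxn (maxn l m).+1 (Num.truncn e^-1)) => k.
rewrite !geq_max => /andP[]; rewrite gtn_max => /andP[lk mk] ek.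
have := nP k l m lk mk; rewrite -gF => nPk.
rewrite sub0r normcN; apply: lt_le_trans nPk _.
rewrite invf_ple ?posrE// ltW// (lt_le_trans (truncnS_gt _))// ler_nat ltnS//.
Qed.

End weak_approximation.

Theorem proposition4p1 (R : realType) (mu : probability (borel_circle R) R)
    (E : set (circle R))
    (kE : kronecker_set E) (muE : mu (~` E) = 0%E)
    (mu_cont : forall z : circle R, mu [set z] = 0%E) :
  weak_limit_semigroup (mulz mu) =
    [set S : {linear L2 mu -> L2 mu} |
      L2contraction S /\ S \o mulz mu = mulz mu \o S] /\
  [set S : {linear L2 mu -> L2 mu} |
      L2contraction S /\ S \o mulz mu = mulz mu \o S] =
    [set S : {linear L2 mu -> L2 mu} |
      exists2 g : Linfty mu, (cLnorm mu +oo%E g <= 1)%E & S = mulop g].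
Proof.
split; apply/seteqP; split=> S.
- exact: weak_limit_contraction_commute.
- move=> [S1 Sz]; have [g g1 ->] := commuting_mulop kE muE S1 Sz.
  exact: mulop_weak_limit kE muE mu_cont _ g1.
- by move=> [S1 Sz]; exact: commuting_mulop kE muE _ S1 Sz.
- move=> [g g1 ->]; apply: weak_limit_contraction_commute.
  exact: mulop_weak_limit kE muE mu_cont _ g1.
Qed.
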